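(* Let $\Bbbk$ be a field, let $G$ be a finite simple graph on the vertex set $[n]$, and let $S=\Bbbk[x_1,\dots,x_n]$. If $\mathrm{reg}(S/I(G))=\mathrm{im}(G)$, then $$\max\{j : \beta_{i,i+j}(S/I(G))\neq 0\}=i\quad\text{for all }i\leq\mathrm{im}(G).$$ In particular, $S_{r}\text{-}\mathrm{depth}(S/J(G))=n-r-1$.
   Context: Here $r\ge 2$ is an integer, $\mathfrak m=(x_1,\dots,x_n)$ and $\omega_S$ is the canonical module of $S$. For an unmixed finitely generated graded $S$-module $M$ and $r\ge 2$, $S_r\text{-}\mathrm{depth}(M)=\min\{j : \dim K_M^j\ge j-r+1\}$, where $K_M^j=\mathrm{Hom}_{\Bbbk}(H^j_{\mathfrak m}(M),\Bbbk)\cong \mathrm{Ext}_S^{n-j}(M,\omega_S)$, $\dim$ is Krull dimension, and $\dim 0=-\infty$. $\beta_{i,j}$ denotes graded Betti numbers over $S$ and $\mathrm{reg}(M)=\max\{j-i : \beta_{i,j}(M)\ne0\}$ is the Castelnuovo–Mumford regularity. The edge ideal is $I(G)=(x_ix_j : \{i,j\}\in E(G))$ and the cover ideal is $J(G)=(x_{i_1}\cdots x_{i_s} : \{i_1,\dots,i_s\}\text{ is a vertex cover of }G)$. A matching of $G$ is a set $M$ of pairwise disjoint edges; it is an induced matching if no edge of $E(G)\setminus M$ is contained in the union of the edges of $M$; $\mathrm{im}(G)$ is the maximal cardinality of an induced matching of $G$.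
   Formalization: The formula for the S_r-depth of S/J(G) is stated only for 2 ≤ r ≤ im(G); for r > im(G) it fails (e.g. G a single edge, n = r = 2, where the S_2-depth is 0, not −1). *)

(* Defs.v *)
From Stdlib Require Import ClassicalEpsilon.
From mathcomp Require Import all_boot all_order all_algebra.
From mathcomp Require Import mpoly.
Set Implicit Arguments.
Unset Strict Implicit.
Unset Printing Implicit Defensive.
Import GRing.Theory Num.Theory.
Local Open Scope ring_scope.

Definition ismax (A : int -> Prop) (m : int) : Prop :=
  A m /\ forall a, A a -> a <= m.

Definition ismin (A : nat -> Prop) (m : nat) : Prop :=
  A m /\ forall a, A a -> (m <= a)%N.

Section Algebra.
Variables (k : fieldType) (n : nat).
Local Notation S := {mpoly k[n]}.

(* The zero polynomial is homogeneous of every degree, also of negative ones. *)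
Definition homogeneous_of (t : int) (p : S) : Prop :=
  forall m, m \in msupp p -> (mdeg m)%:Z = t.

(* A finitely generated graded S-module, written as a subquotient num / den of
   the graded free module with basis e_0, ..., e_(grk - 1), where e_a is
   homogeneous of degree gdeg a. That num and den are graded submodules with
   den contained in num is not recorded: it holds for quoS I, for I a
   homogeneous ideal, and for Ext below. *)
Record gmod := GMod {
  grk : nat;
  gdeg : 'I_grk -> int;
  num : 'rV[S]_grk -> Prop;
  den : 'rV[S]_grk -> Prop }.

Definition zeromod : gmod :=
  @GMod 0 (fun _ => 0) (fun v => v = 0) (fun v => v = 0).

Definition quoS (I : S -> Prop) : gmod :=
  @GMod 1 (fun _ => 0) (fun _ => True) (fun v => I (v 0 0)).

Definition genideal (T : finType) (P : pred T) (g : T -> S) (f : S) : Prop :=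
  exists c : T -> S, f = \sum_(t | P t) c t * g t.

Definition ann (M : gmod) (f : S) : Prop :=
  forall v : 'rV_(grk M), num v -> den (f *: v).

Definition prime_ideal (P : S -> Prop) : Prop :=
  [/\ P 0, forall f g, P f -> P g -> P (f + g), forall f g, P g -> P (f * g),
      ~ P 1 & forall f g, P (f * g) -> P f \/ P g].

(* d <= dim M, where dim M is the Krull dimension of S / ann M. For M = 0 no
   prime contains ann M, so this fails for every d, negative ones included:
   dim 0 is minus infinity. *)
Definition kdim_ge (M : gmod) (d : int) : Prop :=
  exists (t : nat) (p : nat -> S -> Prop),
    [/\ d <= t%:Z,
        forall i, (i <= t)%N -> prime_ideal (p i),
        forall f, ann M f -> p 0%N f
      & forall i, (i < t)%N ->
          (forall f, p i f -> p i.+1 f) /\ (exists f, p i.+1 f /\ ~ p i f)].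

(* A sequence of graded free modules F_i of rank crk i, with basis elements in
   degrees csh i a, and maps F_(i+1) -> F_i, v |-> v *m cd i; caug represents
   the augmentation from F_0 to the free module of which M is a subquotient. *)
Record gcomplex (m : nat) := GComplex {
  crk : nat -> nat;
  csh : forall i, 'I_(crk i) -> int;
  cd : forall i, 'M[S]_(crk i.+1, crk i);
  caug : 'M[S]_(crk 0, m) }.
Arguments csh {m} _ _ _.
Arguments cd {m} _ _.

Definition gcomplex0 m : gcomplex m :=
  @GComplex m (fun _ => 0%N) (fun _ _ => 0) (fun _ => 0) 0.

(* ... -> F_1 -> F_0 -> M -> 0 is exact, with maps homogeneous of degree 0. *)
Definition graded_free_resolution (M : gmod) (F : gcomplex (grk M)) : Prop :=
  [/\ forall a b, homogeneous_of (csh F 0 a - gdeg b) (caug F a b),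
      forall i a b, homogeneous_of (csh F i.+1 a - csh F i b) (cd F i a b),
      (forall v : 'rV_(crk F 0), num (v *m caug F))
        /\ (forall u : 'rV_(grk M), num u ->
              exists v : 'rV_(crk F 0), den (u - v *m caug F)),
      forall v : 'rV_(crk F 0),
        den (v *m caug F) <-> exists w, v = w *m cd F 0
    & forall i (v : 'rV_(crk F i.+1)),
        v *m cd F i = 0 <-> exists w, v = w *m cd F i.+1].

(* Every finitely generated graded module has such a resolution; Tor and Ext
   do not depend, up to graded isomorphism, on the one that is chosen. *)
Definition resolution (M : gmod) : gcomplex (grk M) :=
  epsilon (inhabits (gcomplex0 (grk M))) (@graded_free_resolution M).

(* The matrices over k of the complex F (x)_S k, with k = S / (x_1, ..., x_n). *)
Definition cdk m (F : gcomplex m) i : 'M[k]_(crk F i.+1, crk F i) :=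
  map_mx (mcoeff 0%MM) (cd F i).

(* The projection of F_i (x)_S k onto its component of degree j. *)
Definition degpart m (F : gcomplex m) i (j : int) : 'M[k]_(crk F i) :=
  diag_mx (\row_a (csh F i a == j)%:R).

Definition cycles m (F : gcomplex m) i : 'M[k]_(crk F i) :=
  match i return 'M[k]_(crk F i) with
  | 0 => 1%:M
  | i'.+1 => kermx (cdk F i')
  end.

(* beta_(i,j)(M) = dim_k Tor_i^S(M, k)_j. *)
Definition betti (M : gmod) (i : nat) (j : int) : nat :=
  let F := resolution M in
  (\rank (cycles F i :&: degpart F i j)%MS
     - \rank (degpart F i.+1 j *m cdk F i))%N.

Definition is_reg (M : gmod) (m : int) : Prop :=
  ismax (fun t => exists i j, betti M i j <> 0%N /\ t = j - i%:Z) m.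

(* Ext^i_S(M, omega_S) with omega_S = S(-n): the dual basis of
   Hom_S(F_i, S(-n)) sits in degrees n - csh F i a, and on coordinates in the
   dual bases precomposition with F_(i+1) -> F_i is v |-> v *m (cd F i)^T. *)
Definition cobnd m (F : gcomplex m) i : 'rV[S]_(crk F i) -> Prop :=
  match i return 'rV[S]_(crk F i) -> Prop with
  | 0 => fun v => v = 0
  | i'.+1 => fun v => exists w : 'rV_(crk F i'), v = w *m (cd F i')^T
  end.

Definition Ext (M : gmod) (i : nat) : gmod :=
  let F := resolution M in
  @GMod (crk F i) (fun a => n%:Z - csh F i a)
    (fun v => v *m (cd F i)^T = 0) (@cobnd _ F i).

(* K_M^j = Ext^(n-j)_S(M, omega_S), which is 0 for j > n. *)
Definition Kmod (M : gmod) (j : nat) : gmod :=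
  if (j <= n)%N then Ext M (n - j) else zeromod.

Definition is_Sr_depth (r : nat) (M : gmod) (d : nat) : Prop :=
  ismin (fun j => kdim_ge (Kmod M j) (j%:Z - r%:Z + 1)) d.

End Algebra.

Section Graph.
Variables (n : nat) (e : rel 'I_n).

Definition edges : {set {set 'I_n}} :=
  [set [set ij.1; ij.2] | ij : 'I_n * 'I_n & e ij.1 ij.2].

Definition vertex_cover (C : {set 'I_n}) : bool :=
  [forall A in edges, A :&: C != set0].

Definition matching (M : {set {set 'I_n}}) : bool :=
  (M \subset edges) && trivIset M.

Definition induced_matching (M : {set {set 'I_n}}) : bool :=
  matching M && [forall A in edges :\: M, ~~ (A \subset cover M)].

Definition im : nat := \max_(M | induced_matching M) #|M|.

Variable k : fieldType.

Definition edge_ideal : {mpoly k[n]} -> Prop :=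
  genideal (fun ij : 'I_n * 'I_n => e ij.1 ij.2) (fun ij => 'X_ij.1 * 'X_ij.2).

Definition cover_ideal : {mpoly k[n]} -> Prop :=
  genideal vertex_cover (fun C => \prod_(i in C) 'X_i).

End Graph.

Arguments edge_ideal {n} e k _.
Arguments cover_ideal {n} e k _.

(* Main.v *)
From mathcomp Require Import mpoly.
Require Import Defs.
From HB Require Import structures.
From Stdlib Require Import ClassicalEpsilon FunctionalExtensionality.
From Stdlib Require Import PropExtensionality.
From mathcomp Require Import all_boot all_order all_algebra.
From mathcomp Require Import zify ring.
Set Implicit Arguments.
Unset Strict Implicit.
Unset Printing Implicit Defensive.
Import Order.TTheory GRing.Theory Num.Theory.
Local Open Scope ring_scope.

(**
Taylor's resolution of S/I(G) gives beta_(i,j) = 0 for j > 2i. Conversely, let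
u be the list of the i monomials of an induced matching with vertex set W and
t the remaining variables. The inclusion of the Koszul complex of u into that
of (t, u) factors, up to homotopy, through any resolution of S/I(G), because
(u) <= I(G) <= (t, u); as both Koszul complexes are minimal, the top generator
of the first, of degree 2i, survives in Tor_i(S/I(G), k).

For the depth of S/J(G), let J(V) be the cover ideal of the subgraph induced on
V. The maps S/J(G) -> S/J(V) -> S/J(G), the second one being multiplication by
the product x_F of the variables outside V, compose to x_F. Splitting covers
according to whether they contain a given vertex v shows that S/J(V) has a free
resolution of length at most |V|/2 + 1, so x_F kills Ext^i(S/J(G), S) as soon
as i > |V|/2 + 1; this bounds the dimension of Ext^(n-j) for j < n - r - 1. For
V the vertex set of an induced matching with r edges, the last map of the
resolution of S/J(V) has entries in the prime (x_v : v in V), which therefore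
contains the annihilator of Ext^(r+1)(S/J(G), S), and S/(x_v : v in V) has
dimension n - 2r.
*)

Arguments csh {k n m} _ _ _.
Arguments cd {k n m} _ _.

(** * Free resolutions and mapping cones *)

Lemma mulmx_choice (R : comNzRingType) p q r (A : 'M[R]_(p, r))
    (B : 'M[R]_(q, r)) :
  (forall v : 'rV_p, exists w : 'rV_q, v *m A = w *m B) ->
  exists X, A = X *m B.
Proof.
move=> h.
have [f fE] := fin_all_exists (fun a => h (delta_mx 0 a)).
exists (\matrix_a f a); apply/row_matrixP => a.
by rewrite row_mul rowK -fE -rowE.
Qed.

Section Complexes.
Variables (k : fieldType) (n : nat).
Local Notation S := {mpoly k[n]}.
Implicit Types M : gmod k n.

(** A [gmod] does not record that [num] and [den] are submodules, so this travels as a separate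
    hypothesis. *)
Definition submod m (D : 'rV[S]_m -> Prop) : Prop :=
  [/\ D 0, forall u v, D u -> D v -> D (u + v) & forall c u, D u -> D (c *: u)].

Lemma submodN m (D : 'rV[S]_m -> Prop) u : submod D -> D u -> D (- u).
Proof. by case=> _ _ hZ hu; rewrite -scaleN1r; apply: hZ. Qed.

Lemma submodB m (D : 'rV[S]_m -> Prop) u v :
  submod D -> D u -> D v -> D (u - v).
Proof. by move=> hD hu hv; case: (hD) => _ hA _; apply: hA => //; apply:
  submodN. Qed.

Lemma submod_mul m p (D : 'rV[S]_m -> Prop) (A : 'M_(p, m)) v :
  submod D -> (forall a, D (row a A)) -> D (v *m A).
Proof.
move=> [h0 hA hZ] hrow; rewrite mulmx_sum_row.
by elim/big_ind: _ => // a _; apply: hZ.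
Qed.

(** [graded_free_resolution] without its degree conditions: lifting and homotopy arguments use
    exactness alone. *)
Definition resolves M (F : gcomplex k n (grk M)) : Prop :=
  [/\ (forall v : 'rV_(crk F 0), num (v *m caug F))
        /\ (forall u : 'rV_(grk M), num u ->
              exists v : 'rV_(crk F 0), den (u - v *m caug F)),
      forall v : 'rV_(crk F 0),
        den (v *m caug F) <-> exists w, v = w *m cd F 0
    & forall i (v : 'rV_(crk F i.+1)),
        v *m cd F i = 0 <-> exists w, v = w *m cd F i.+1].
Arguments resolves M F : clear implicits.

Definition homogeneous_cpx m (F : gcomplex k n m) : Prop :=
  forall i a b, homogeneous_of (csh F i.+1 a - csh F i b) (cd F i a b).

Definition complex m (F : gcomplex k n m) : Prop :=
  forall i, cd F i.+1 *m cd F i = 0.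

Lemma resolves_complex M (F : gcomplex k n (grk M)) : resolves M F -> complex F.
Proof.
case=> _ _ ex i; apply/row_matrixP => a; rewrite row_mul row0.
by apply/ex; exists (delta_mx 0 a); rewrite -rowE.
Qed.

Lemma resolves_den M (F : gcomplex k n (grk M)) :
  resolves M F -> forall w, den (w *m cd F 0 *m caug F).
Proof. by case=> _ ex _ w; apply/ex; exists w. Qed.

Definition chain_map m m' (F : gcomplex k n m) (G : gcomplex k n m')
    (phi : forall i, 'M[S]_(crk F i, crk G i)) : Prop :=
  forall i, phi i.+1 *m cd G i = cd F i *m phi i.
Arguments chain_map [m m'] F G phi.

(** [P] acts on the ambient free modules and [M'] is a subquotient, so the square with the
    augmentations commutes only modulo [den]. *)
Definition lifts m M' (F : gcomplex k n m) (G : gcomplex k n (grk M'))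
    (P : 'M_(m, grk M')) (phi : forall i, 'M[S]_(crk F i, crk G i)) : Prop :=
  chain_map F G phi /\
  forall v, den (v *m (caug F *m P - phi 0%N *m caug G)).
Arguments lifts [m] M' F G P phi.

(** Comparison theorem: only [G] has to be exact, [F] may be any complex. *)
Lemma comparison m M' (F : gcomplex k n m) (G : gcomplex k n (grk M'))
    (P : 'M_(m, grk M')) :
  submod (@den _ _ M') -> complex F ->
  (forall v, num (v *m caug F *m P)) ->
  (forall w, den (w *m cd F 0 *m caug F *m P)) ->
  resolves M' G -> exists phi, lifts M' F G P phi.
Proof.
move=> sD cF hnum hden [[_ onto] ex0 ex].
have h0 a : exists w : 'rV_(crk G 0), den (row a (caug F *m P) - w *m caug G).
  by apply: onto; rewrite rowE mulmxA.
have {h0}[f fE] := fin_all_exists h0.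
pose phi0 : 'M_(crk F 0, crk G 0) := \matrix_a f a.
have aug0 v : den (v *m (caug F *m P - phi0 *m caug G)).
  apply: submod_mul => // a; rewrite linearB /= [row a (phi0 *m _)]row_mul rowK.
  exact: fE.
(* Each lift depends on the previous one, so the recursion picks it by [epsilon], with default 0;
   existence is proved by induction afterwards. *)
pose step i (X : 'M_(crk F i, crk G i)) : 'M_(crk F i.+1, crk G i.+1) :=
  epsilon (inhabits 0) (fun Y => cd F i *m X = Y *m cd G i).
pose phi := nat_rect (fun i => 'M_(crk F i, crk G i)) phi0 step.
exists phi; split=> // i.
suff : cd F i *m phi i = phi i.+1 *m cd G i by [].
apply: (@epsilon_spec _ (inhabits 0) (fun Y => cd F i *m phi i = Y *m cd G i)).
apply: mulmx_choice => v.
elim: i v => [|i IH] v.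
  apply/ex0; rewrite [phi 0%N]/=.
  have -> : v *m (cd F 0 *m phi0) *m caug G = v *m cd F 0 *m caug F *m P
     - (v *m cd F 0) *m (caug F *m P - phi0 *m caug G).
    by rewrite mulmxBr !mulmxA opprB addrC subrK.
  exact: submodB.
apply/ex.
have /(@epsilon_spec _ (inhabits 0)) E :
    exists Y, cd F i *m phi i = Y *m cd G i by apply: mulmx_choice.
by rewrite -!mulmxA -[phi i.+1 *m _]E !mulmxA -[v *m _ *m _]mulmxA cF mulmx0
  mul0mx.
Qed.

(** The condition on [phi 0] says that [phi] induces zero on the augmented module; exactness of [G]
    then yields the homotopy degree by degree. *)
Lemma null_homotopic m M' (F : gcomplex k n m) (G : gcomplex k n (grk M'))
    (phi : forall i, 'M[S]_(crk F i, crk G i)) :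
  complex F -> resolves M' G -> chain_map F G phi ->
  (forall v, den (v *m phi 0%N *m caug G)) ->
  exists h : forall i, 'M[S]_(crk F i, crk G i.+1),
    phi 0%N = h 0%N *m cd G 0 /\
    forall i, phi i.+1 = h i.+1 *m cd G i.+1 + cd F i *m h i.
Proof.
move=> cF [_ ex0 ex] cphi hden.
have [h0 h0E] : exists X, phi 0%N = X *m cd G 0.
  by apply: mulmx_choice => v; apply/ex0.
pose step i (X : 'M_(crk F i, crk G i.+1)) : 'M_(crk F i.+1, crk G i.+2) :=
  epsilon (inhabits 0) (fun Y => phi i.+1 - cd F i *m X = Y *m cd G i.+1).
pose h := nat_rect (fun i => 'M_(crk F i, crk G i.+1)) h0 step.
have key i : cd F i *m (phi i - h i *m cd G i) = 0 ->
    phi i.+1 - cd F i *m h i = h i.+1 *m cd G i.+1.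
  move=> E; apply: (@epsilon_spec _ _ (fun Y => _ = Y *m _)).
  apply: mulmx_choice => v.
  by apply/ex; rewrite -mulmxA mulmxBl cphi -mulmxA -mulmxBr E mulmx0.
(* The defect in degree [i.+1] is [cd F i *m h i], which the next differential kills because [F] is
   a complex. *)
have keyE i : cd F i *m (phi i - h i *m cd G i) = 0.
  elim: i => [|i IH]; first by rewrite {1}h0E subrr mulmx0.
  by rewrite -(key i IH) opprB addrC subrK mulmxA cF mul0mx.
by exists h; split=> // i; rewrite -key ?keyE // subrK.
Qed.

Section ConeComplex.
Variables (m1 m2 m3 : nat) (delta : int).
Variables (X : gcomplex k n m1) (Y : gcomplex k n m2).
Variables (phi : forall i, 'M[S]_(crk X i, crk Y i)) (Q : 'M[S]_(m2, m3)).

Definition cone_rk (i : nat) : nat :=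
  match i with 0 => crk Y 0 | j.+1 => (crk Y j.+1 + crk X j)%N end.

(** When [phi] has degree [delta], shifting [X] by it makes the blocks of [cone_d] homogeneous of
    degree 0. *)
Definition cone_sh (i : nat) : 'I_(cone_rk i) -> int :=
  match i return 'I_(cone_rk i) -> int with
  | 0 => csh Y 0
  | j.+1 => fun a => match split a with
                     | inl b => csh Y j.+1 b
                     | inr b => csh X j b + delta
                     end
  end.

Definition cone_d (i : nat) : 'M[S]_(cone_rk i.+1, cone_rk i) :=
  match i return 'M[S]_(cone_rk i.+1, cone_rk i) with
  | 0 => col_mx (cd Y 0) (phi 0%N)
  | j.+1 => block_mx (cd Y j.+1) 0 (phi j.+1) (- cd X j)
  end.

Definition cone : gcomplex k n m3 :=
  @GComplex k n m3 cone_rk cone_sh cone_d (caug Y *m Q).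
End ConeComplex.

Section Cone.
Variables (M1 M2 M3 : gmod k n) (delta : int).
Variables (X : gcomplex k n (grk M1)) (Y : gcomplex k n (grk M2)).
Variables (phi : forall i, 'M[S]_(crk X i, crk Y i)).
Variables (P : 'M[S]_(grk M1, grk M2)) (Q : 'M[S]_(grk M2, grk M3)).

(* The cone resolves the cokernel M3 of an injective map P : M1 -> M2. *)
Lemma cone_resolves :
  submod (@num _ _ M2) -> submod (@den _ _ M2) -> submod (@den _ _ M3) ->
  (forall v : 'rV_(grk M2), den v -> num v) ->
  resolves M1 X -> resolves M2 Y -> lifts M2 X Y P phi ->
  (forall v : 'rV_(grk M2), num v -> num (v *m Q)) ->
  (forall u : 'rV_(grk M3), num u ->
     exists2 v : 'rV_(grk M2), num v & den (u - v *m Q)) ->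
  (forall v : 'rV_(grk M2), num v ->
     (den (v *m Q) <->
      exists2 u : 'rV_(grk M1), num u & den (v - u *m P))) ->
  (forall u : 'rV_(grk M1), den u -> den (u *m P)) ->
  (forall u : 'rV_(grk M1), num u -> den (u *m P) -> den u) ->
  resolves M3 (cone delta phi Q).
Proof.
move=> sN2 sD2 sD3 dn2 [[numX ontoX] exX0 exX] [[numY ontoY] exY0 exY].
move=> [cphi lphi] numQ ontoQ denQ denP injP.
split.
- split=> [v|u /ontoQ [v hv hu]] /=.
    by rewrite mulmxA; apply: numQ.
  have [w hw] := ontoY v hv; exists w.
  have -> : u - w *m (caug Y *m Q) = u - v *m Q + (v - w *m caug Y) *m Q.
    by rewrite mulmxBl addrA subrK mulmxA.
  case: (sD3) => _ hA _; apply: (hA) => //.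
  apply/denQ; first exact: dn2.
  exists 0; first by rewrite -(mul0mx _ (caug X)); apply: numX.
  by rewrite mul0mx subr0.
- move=> v /=; rewrite mulmxA denQ //; split.
    case=> u hu hd; have [w hw] := ontoX u hu.
    have : den ((v - w *m phi 0%N) *m caug Y).
      have -> : (v - w *m phi 0%N) *m caug Y = v *m caug Y - u *m P
         + (u - w *m caug X) *m P + w *m (caug X *m P - phi 0%N *m caug Y).
        by rewrite mulmxBr !mulmxBl !mulmxA !addrA !subrK.
      by case: (sD2) => _ hA _; apply: (hA) => //; apply: (hA) => //; apply:
        denP.
    move/exY0 => [w' E]; exists (row_mx w' w).
    by rewrite mul_row_col -E subrK.
  case=> w ->; exists (rsubmx w *m caug X) => //.
  rewrite -[w in w *m col_mx _ _]hsubmxK mul_row_col mulmxDl.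
  have -> : lsubmx w *m cd Y 0 *m caug Y + rsubmx w *m phi 0%N *m caug Y
      - rsubmx w *m caug X *m P = lsubmx w *m cd Y 0 *m caug Y -
        rsubmx w *m (caug X *m P - phi 0%N *m caug Y).
    by rewrite mulmxBr !mulmxA opprB addrA.
  by apply: submodB => //; apply/exY0; exists (lsubmx w).
- have cX : complex X by apply: (@resolves_complex M1).
  have cY : complex Y by apply: (@resolves_complex M2).
  (* If the [X]-component of a cycle is the boundary of [x'], then [y] plus the image of [x'] is a
     cycle of [Y], hence a boundary. *)
  have aux i (y : 'rV_(crk Y i.+1)) (x : 'rV_(crk X i)) (x' : 'rV_(crk X i.+1))
    :
      x = x' *m cd X i -> y *m cd Y i + x *m phi i = 0 ->
      exists w : 'rV_(crk Y i.+2 + crk X i.+1),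
        row_mx y x = w *m block_mx (cd Y i.+1) 0 (phi i.+1) (- cd X i).
    move=> -> E.
    have /exY [y' Ey] : (y + x' *m phi i.+1) *m cd Y i = 0.
      by rewrite mulmxDl -mulmxA cphi mulmxA.
    exists (row_mx y' (- x')).
    by rewrite mul_row_block mulmx0 add0r mulNmx mulmxN mulNmx opprK -Ey addrK.
  case=> [|i] v /=.
    split=> [|[w ->]]; last first.
      rewrite -[w]hsubmxK mul_row_block mul_row_col mulmx0 add0r.
      rewrite mulmxN mulNmx mulmxDl -!mulmxA cY mulmx0 add0r cphi.
      by rewrite subrr.
    rewrite -[v]hsubmxK mul_row_col => E.
    (* Injectivity of [P] enters here: the augmentation of the [X]-component is sent by [P] into
       [den]. *)
    have /exX0 [x' Ex] : den (rsubmx v *m caug X).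
      apply: injP => //.
      have -> : rsubmx v *m caug X *m P =
          rsubmx v *m (caug X *m P - phi 0%N *m caug Y)
          - lsubmx v *m cd Y 0 *m caug Y.
        have E' : rsubmx v *m phi 0%N = - (lsubmx v *m cd Y 0).
          by apply/eqP; rewrite -addr_eq0 addrC E.
        rewrite mulmxBr !mulmxA [_ *m phi 0%N]E' mulNmx opprK.
        by rewrite -addrA subrr addr0.
      by apply: submodB => //; apply/exY0; exists (lsubmx v).
    exact: aux Ex E.
  split=> [|[w ->]]; last first.
    rewrite -[w]hsubmxK !mul_row_block !mulmx0 !add0r.
    rewrite mulmxDl !mulmxN !mulNmx -!mulmxA cY cX mulmx0 add0r cphi.
    rewrite ?mulmx0 ?oppr0.
    by rewrite subrr row_mx0.
  rewrite -[v]hsubmxK mul_row_block mulmx0 add0r => E.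
  have [E1] : lsubmx v *m cd Y i.+1 + rsubmx v *m phi i.+1 = 0 /\
     rsubmx v *m cd X i = 0.
    move: E; rewrite -row_mx0 => /eq_row_mx [-> E]; split=> //.
    by rewrite -[LHS]opprK -mulmxN E oppr0.
  by move/exX => [x' Ex]; apply: aux Ex E1.
Qed.
End Cone.

(** * Direct sums of resolutions *)

Section DirectSum.
Variables (M1 M2 : gmod k n).
Variables (F : gcomplex k n (grk M1)) (G : gcomplex k n (grk M2)).

Definition dsum_mod : gmod k n :=
  @GMod k n (grk M1 + grk M2) (fun _ => 0)
    (fun v => @num _ _ M1 (lsubmx v) /\ @num _ _ M2 (rsubmx v))
    (fun v => @den _ _ M1 (lsubmx v) /\ @den _ _ M2 (rsubmx v)).

Definition dsum : gcomplex k n (grk dsum_mod) :=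
  @GComplex k n (grk dsum_mod) (fun i => crk F i + crk G i)%N (fun _ _ => 0)
    (fun i => block_mx (cd F i) 0 0 (cd G i)) (block_mx (caug F) 0 0 (caug G)).

Let mul_diag p1 p2 q1 q2 (v : 'rV[S]_(p1 + p2)) (A : 'M_(p1, q1))
    (B : 'M_(p2, q2)) :
  v *m block_mx A 0 0 B = row_mx (lsubmx v *m A) (rsubmx v *m B).
Proof. by rewrite -{1}[v]hsubmxK mul_row_block !mulmx0 addr0 add0r. Qed.

Lemma dsum_resolves :
  resolves M1 F -> resolves M2 G -> resolves dsum_mod dsum.
Proof.
move=> [[numF ontoF] exF0 exF] [[numG ontoG] exG0 exG].
split=> [|v|i v].
- split=> [v|u [/ontoF [v hv] /ontoG [w hw]]] /=.
    by rewrite mul_diag row_mxKl row_mxKr.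
  exists (row_mx v w); rewrite mul_diag !linearB /= !row_mxKl !row_mxKr.
  by split.
- rewrite /= mul_diag row_mxKl row_mxKr; split.
    move=> [/exF0 [x Ex] /exG0 [y Ey]]; exists (row_mx x y).
    by rewrite mul_diag row_mxKl row_mxKr -Ex -Ey hsubmxK.
  case=> w ->; rewrite mul_diag row_mxKl row_mxKr.
  by split; [apply/exF0; exists (lsubmx w) | apply/exG0; exists (rsubmx w)].
- rewrite /= mul_diag; split.
    rewrite -row_mx0 => /eq_row_mx [/exF [x Ex] /exG [y Ey]].
    exists (row_mx x y).
    by rewrite mul_diag row_mxKl row_mxKr -Ex -Ey hsubmxK.
  case=> w ->; rewrite mul_diag row_mxKl row_mxKr.
  have -> : lsubmx w *m cd F i.+1 *m cd F i = 0 by apply/exF; exists (lsubmx w).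
  have -> : rsubmx w *m cd G i.+1 *m cd G i = 0 by apply/exG; exists (rsubmx w).
  by rewrite row_mx0.
Qed.

Lemma dsum_lifts m (X : gcomplex k n m) P1 P2 phi psi :
  lifts M1 X F P1 phi -> lifts M2 X G P2 psi ->
  lifts dsum_mod X dsum (row_mx P1 P2) (fun i => row_mx (phi i) (psi i)).
Proof.
move=> [cphi lphi] [cpsi lpsi]; split=> [i|v] /=.
  by rewrite mul_row_block !mulmx0 addr0 add0r cphi cpsi mul_mx_row.
rewrite mul_mx_row mul_row_block !mulmx0 addr0 add0r opp_row_mx add_row_mx.
by rewrite mul_mx_row row_mxKl row_mxKr.
Qed.
End DirectSum.
End Complexes.

Arguments resolves {k n} M F.
Arguments chain_map {k n m m'} F G phi.
Arguments lifts {k n m} M' F G P phi.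

(** * Homogeneous maps *)

Section Homogeneous.
Variables (k : fieldType) (n : nat).
Local Notation S := {mpoly k[n]}.
Implicit Types (p q : S) (s t : int).

Definition hcomp t p : S :=
  \sum_(m <- msupp p | (mdeg m)%:Z == t) p@_m *: 'X_[m].

Lemma mcoeff_hcomp t p m :
  (hcomp t p)@_m = if (mdeg m)%:Z == t then p@_m else 0.
Proof.
rewrite /hcomp raddf_sum /=.
under eq_bigr do rewrite mcoeffZ mcoeffX.
have [mp|/memN_msupp_eq0 E] := boolP (m \in msupp p).
  rewrite big_mkcond (bigD1_seq m) ?msupp_uniq //= eqxx mulr1.
  rewrite big1 ?addr0 // => m' /negPf ->.
  by rewrite mulr0 if_same.
rewrite E if_same big1 // => m' _.
by have [->|_] := eqVneq m' m; rewrite ?E ?mul0r ?mulr0.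
Qed.

Lemma homogeneous_ofP t p :
  homogeneous_of t p <-> (forall m, p@_m != 0 -> (mdeg m)%:Z = t).
Proof. by split=> h m; [rewrite -mcoeff_msupp|rewrite mcoeff_msupp]; apply: h.
  Qed.

Lemma hcomp_homogeneous t p : homogeneous_of t (hcomp t p).
Proof.
apply/homogeneous_ofP => m; rewrite mcoeff_hcomp.
by case: ifP => [/eqP -> //|_ /eqP].
Qed.

Lemma hcomp_id t p : homogeneous_of t p -> hcomp t p = p.
Proof.
move=> /homogeneous_ofP h; apply/mpolyP => m; rewrite mcoeff_hcomp.
case: ifP => // /eqP ne; apply/esym/eqP; apply: contra_notT ne; exact: h.
Qed.

Lemma hcomp_is_additive t : additive (hcomp t).
Proof.
move=> p q; apply/mpolyP => m; rewrite mcoeffB !mcoeff_hcomp mcoeffB.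
by case: ifP; rewrite ?subr0.
Qed.
HB.instance Definition _ t :=
  GRing.isAdditive.Build S S (hcomp t) (hcomp_is_additive t).

Lemma homogeneous_of0 t : homogeneous_of t (0 : S).
Proof. by move=> m; rewrite msupp0. Qed.

Lemma homogeneous_ofN t p : homogeneous_of t p -> homogeneous_of t (- p).
Proof. by move=> hp m; rewrite (perm_mem (msuppN p)); apply: hp. Qed.

Lemma homogeneous_ofM s t p q :
  homogeneous_of s p -> homogeneous_of t q -> homogeneous_of (s + t) (p * q).
Proof.
move=> hp hq m /msuppM_le /allpairsP [[m1 m2] /= [/hp <- /hq <- ->]].
by rewrite mdegD PoszD.
Qed.

(** A product of a term of [p] with a term of [q] has degree [t + s] exactly when the term of [p]
    has degree [t]. *)
Lemma hcompM s t p q : homogeneous_of s q ->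
  hcomp (t + s) (p * q) = hcomp t p * q.
Proof.
move=> hq; rewrite -{1}[p](subrK (hcomp t p)) mulrDl raddfD /=.
rewrite [X in _ + X]hcomp_id; last first.
  by apply: homogeneous_ofM => //; apply: hcomp_homogeneous.
rewrite [X in X + _](_ : _ = 0) ?add0r //; apply/mpolyP => m.
rewrite mcoeff_hcomp mcoeff0; case: eqP => // Em; apply/eqP.
rewrite mcoeff_eq0; apply/negP => /msuppM_le /allpairsP [[m1 m2] /=].
rewrite mcoeff_msupp mcoeffB mcoeff_hcomp => -[+ /hq E2 E].
have -> : (mdeg m1)%:Z == t.
  by rewrite -(inj_eq (addIr s)) -{1}E2 -PoszD -mdegD -E Em.
by rewrite subrr eqxx.
Qed.

Definition homogeneous_mx (p q : nat) (s : 'I_p -> int) (t : 'I_q -> int)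
    (A : 'M[S]_(p, q)) : Prop :=
  forall a b, homogeneous_of (s a - t b) (A a b).

(** The degree-0 part of the map [A], for row basis elements of degrees [s] and column basis
    elements of degrees [t]. *)
Definition hmx (p q : nat) (s : 'I_p -> int) (t : 'I_q -> int) (A : 'M[S]_(p,
  q)) :=
  \matrix_(a, b) hcomp (s a - t b) (A a b).

Lemma hmx_homogeneous (p q : nat) (s : 'I_p -> int) (t : 'I_q -> int) (A :
  'M_(p, q)) : homogeneous_mx s t (hmx s t A).
Proof. by move=> a b; rewrite mxE; apply: hcomp_homogeneous. Qed.

Lemma hmx_id (p q : nat) (s : 'I_p -> int) (t : 'I_q -> int) (A : 'M_(p, q)) :
  homogeneous_mx s t A -> hmx s t A = A.
Proof. by move=> hA; apply/matrixP => a b; rewrite mxE hcomp_id. Qed.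

Lemma hmxB (p q : nat) (s : 'I_p -> int) (t : 'I_q -> int) (A B : 'M_(p, q)) :
  hmx s t (A - B) = hmx s t A - hmx s t B.
Proof. by apply/matrixP => a b; rewrite !mxE raddfB. Qed.

Lemma hmx_mulr (p q r : nat) (s : 'I_p -> int) (t : 'I_q -> int)
    (u : 'I_r -> int) (A : 'M_(p, q)) (B : 'M_(q, r)) :
  homogeneous_mx t u B -> hmx s u (A *m B) = hmx s t A *m B.
Proof.
move=> hB; apply/matrixP => a c; rewrite !mxE raddf_sum /=.
apply: eq_bigr => b _; rewrite mxE -[s a - u c](subrKA (t b)).
by rewrite (hcompM _ _ (hB b c)).
Qed.

Lemma hmx_mull (p q r : nat) (s : 'I_p -> int) (t : 'I_q -> int)
    (u : 'I_r -> int) (A : 'M_(p, q)) (B : 'M_(q, r)) :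
  homogeneous_mx s t A -> hmx s u (A *m B) = A *m hmx t u B.
Proof.
move=> hA; apply/matrixP => a c; rewrite !mxE raddf_sum /=.
apply: eq_bigr => b _; rewrite mxE -[s a - u c](subrKA (t b)) addrC.
by rewrite mulrC (hcompM _ _ (hA a b)) mulrC.
Qed.

Definition homogeneous_id (I : S -> Prop) := forall t f, I f -> I (hcomp t f).

(** The degree-[d] parts of [phi] still form a lift: differentials and augmentations are
    homogeneous, and [I] contains the components of its elements. *)
Lemma graded_lift (I : S -> Prop) (F : gcomplex k n 1)
    (G : gcomplex k n (grk (quoS I))) (P : 'M_1) d phi :
  submod (@den _ _ (quoS I)) -> homogeneous_id I ->
  homogeneous_cpx F -> homogeneous_mx (csh F 0) (fun _ => 0) (caug F) ->
  homogeneous_cpx G -> homogeneous_mx (csh G 0) (fun _ => 0) (caug G) ->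
  homogeneous_of d (P 0 0) -> lifts (quoS I) F G P phi ->
  exists2 psi, lifts (quoS I) F G P psi &
    forall i, homogeneous_mx (fun a => csh F i a + d) (csh G i) (psi i).
Proof.
move=> sI hI hF haF hG haG hP [cphi lphi].
have hF' i : homogeneous_mx (fun a => csh F i.+1 a + d) (fun a => csh F i a + d)
   (cd F i).
  by move=> a b; rewrite /= [csh F i b + d]addrC addrKA; apply: hF.
have haF' : homogeneous_mx (fun a => csh F 0 a + d) (fun _ => 0) (caug F *m P).
  move=> a b; rewrite mxE big_ord1 !ord1 subr0; apply: homogeneous_ofM => //.
  by rewrite -[csh F 0 a]subr0; apply: haF.
exists (fun i => hmx (fun a => csh F i a + d) (csh G i) (phi i)); last first.
  by move=> i; apply: hmx_homogeneous.
split=> [i|v].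
  by rewrite -(hmx_mulr _ _ (hG i)) cphi (hmx_mull _ _ (hF' i)).
apply: submod_mul => // a.
rewrite -(hmx_mulr _ _ haG) -{1}(hmx_id haF') -hmxB /=.
rewrite !mxE; apply: hI.
have := lphi (delta_mx 0 a); rewrite -rowE /=.
by rewrite !mxE.
Qed.

End Homogeneous.

(** * Monomial ideals *)

Section MonomialIdeals.
Variables (k : fieldType) (n : nat).
Local Notation S := {mpoly k[n]}.
Implicit Types (f g : S) (u m : 'X_{1..n}) (Q : pred 'X_{1..n}).

(** A monomial ideal is encoded by the set [Q] of exponents of its monomials; this gives an ideal
    once [Q] is [upward]. *)
Definition monid Q f : Prop := forall m, f@_m != 0 -> Q m.

Definition upward Q := forall m m', Q m -> Q (m + m')%MM.

Lemma eq_monid Q Q' f : Q =1 Q' -> monid Q f <-> monid Q' f.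
Proof. by move=> E; split=> h m /h; rewrite E. Qed.

Lemma monid0 Q : monid Q 0.
Proof. by move=> m; rewrite mcoeff0 eqxx. Qed.

Lemma monidD Q f g : monid Q f -> monid Q g -> monid Q (f + g).
Proof.
move=> hf hg m; rewrite mcoeffD; have [->|/hf //] := eqVneq f@_m 0.
by rewrite add0r; apply: hg.
Qed.

Lemma monidM Q f g : upward Q -> monid Q g -> monid Q (f * g).
Proof.
move=> uQ hg m; rewrite -mcoeff_msupp => /msuppM_le /allpairsP [[m1 m2] /= []].
by rewrite !mcoeff_msupp => _ /hg h ->; rewrite addmC; apply: uQ.
Qed.

Lemma monidX Q u : monid Q 'X_[u] <-> Q u.
Proof.
split=> [|h m]; first by apply; rewrite mcoeffX eqxx oner_eq0.
by rewrite mcoeffX; have [<-|] := eqVneq u m; rewrite ?eqxx.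
Qed.

Lemma mcoeffXM u f m :
  ('X_[u] * f)@_m = if (u <= m)%MM then f@_(m - u) else 0.
Proof.
rewrite mulrC; case: ifP => [/submK {1}<-|h].
  by rewrite addmC mcoeffMX.
apply/eqP; rewrite mcoeff_eq0 (perm_mem (msuppMX f u)).
by apply/negP => /mapP [m' _ E]; move: h; rewrite E lem_addr.
Qed.

Lemma monidMX Q u f :
  monid Q ('X_[u] * f) <-> monid (fun m => Q (u + m)%MM) f.
Proof.
split=> h m.
  by move=> hm; apply: h; rewrite mcoeffXM lem_addr addmC addmK.
by rewrite mcoeffXM; case: ifP => [le|]; rewrite ?eqxx // => /h; rewrite addmC
  submK.
Qed.

Lemma monid_hcomp Q : homogeneous_id (monid Q).
Proof.
move=> t f h m; rewrite mcoeff_hcomp; case: ifP => _; first exact: h.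
by rewrite eqxx.
Qed.

(** Sort the terms of [f]: those divisible by [u1] with quotient in [Q1] go to [f1], all others to
    [f2]. *)
Lemma monid_split Q1 Q2 u1 u2 f :
  monid (fun m => (u1 <= m)%MM && Q1 (m - u1)%MM || (u2 <= m)%MM && Q2 (m -
    u2)%MM)
    f ->
  exists f1 f2, [/\ monid Q1 f1, monid Q2 f2 & f = 'X_[u1] * f1 + 'X_[u2] * f2].
Proof.
move=> hf; pose A1 m := (u1 <= m)%MM && Q1 (m - u1)%MM.
exists (\sum_(m <- msupp f | A1 m) f@_m *: 'X_[m - u1]).
exists (\sum_(m <- msupp f | ~~ A1 m) f@_m *: 'X_[m - u2]).
have monidZ Q c m : Q m -> monid Q (c *: 'X_[m]).
  move=> h m'; rewrite mcoeffZ mcoeffX; have [<-//|_] := eqVneq m m'.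
  by rewrite mulr0 eqxx.
have A2 m : m \in msupp f -> ~~ A1 m -> (u2 <= m)%MM && Q2 (m - u2)%MM.
  by rewrite mcoeff_msupp => /hf /orP [h|//]; rewrite /A1 h.
split.
- rewrite big_seq_cond; elim/big_ind: _ => [||m /andP [_ /andP [_ h]]].
  + exact: monid0.
  + by move=> *; apply: monidD.
  + exact: monidZ.
- rewrite big_seq_cond; elim/big_ind: _ => [||m /andP [h /(A2 _ h) /andP [_
  h']]].
  + exact: monid0.
  + by move=> *; apply: monidD.
  + exact: monidZ.
- rewrite {1}[f]mpolyE (bigID A1) /= !mulr_sumr; congr (_ + _).
    apply: eq_bigr => m /andP [h _].
    by rewrite -scalerAr -mpolyXD addmC submK.
  rewrite big_seq_cond [RHS]big_seq_cond; apply: eq_bigr => m /andP [h].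
  move=> /(A2 _ h) /andP [h' _].
  by rewrite -scalerAr -mpolyXD addmC submK.
Qed.

Lemma mpolyX_dvd u f :
  (forall m, f@_m != 0 -> (u <= m)%MM) -> exists g, f = 'X_[u] * g.
Proof.
move=> h; have [|f1 [f2 [_ hf2 ->]]] := @monid_split predT pred0 u u f.
  by move=> m /h /= ->.
exists f1; suff -> : f2 = 0 by rewrite mulr0 addr0.
by apply/mpolyP => m; rewrite mcoeff0; apply/eqP; apply/negP => /negP /hf2.
Qed.

Lemma mpolyX_neq0 u : 'X_[u] != 0 :> S.
Proof. by rewrite -msize_poly_eq0 msizeX. Qed.

Lemma genideal_monid (T : finType) (P : pred T) (w : T -> 'X_{1..n}) f :
  genideal P (fun t => 'X_[w t]) f <->
  monid (fun m => [exists t, P t && (w t <= m)%MM]) f.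
Proof.
split=> [[c ->]|hf].
  elim/big_ind: _ => [||t Pt]; first exact: monid0.
    by move=> *; apply: monidD.
  rewrite mulrC; apply/monidMX => m _; apply/existsP; exists t.
  by rewrite Pt lem_addr.
rewrite [f]mpolyE big_seq; elim/big_ind: _.
- by exists (fun _ => 0); rewrite big1 // => t _; rewrite mul0r.
- move=> g h [c ->] [d ->]; exists (fun t => c t + d t).
  by rewrite -big_split /=; apply: eq_bigr => t _; rewrite mulrDl.
move=> m; rewrite mcoeff_msupp => /hf /existsP [t /andP [Pt le]].
exists (fun t' => if t' == t then f@_m *: 'X_[m - w t] else 0).
rewrite (bigD1 t) //= eqxx big1 ?addr0.
  by rewrite -scalerAl -mpolyXD submK.
by move=> t' /andP [_ /negPf ->]; rewrite mul0r.
Qed.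

Definition subquo (N D : S -> Prop) : gmod k n :=
  @GMod k n 1 (fun _ => 0) (fun v => N (v 0 0)) (fun v => D (v 0 0)).

Lemma monid_submod Q : upward Q -> submod (fun v : 'rV[S]_1 => monid Q (v 0 0)).
Proof.
move=> uQ; split=> [|u v|c u]; rewrite !mxE; first exact: monid0.
  exact: monidD.
exact: monidM.
Qed.

End MonomialIdeals.

(** * Taylor and Koszul complexes *)

Section MonomialResolutions.
Variables (k : fieldType) (n : nat).
Local Notation S := {mpoly k[n]}.
Implicit Types (s t : seq 'X_{1..n}) (Q : pred 'X_{1..n}).

Lemma resolves_ext (N N' D D' : S -> Prop) F :
  (forall f, N f <-> N' f) -> (forall f, D f <-> D' f) ->
  resolves (subquo N D) F -> resolves (subquo N' D') F.
Proof.
move=> hN hD [[numF onto] ex0 ex]; split=> // [|v].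
  split=> [v|u /= /hN hu]; first by apply/hN; apply: numF.
  by have [v hv] := onto u hu; exists v; apply/hD.
by rewrite -ex0; split=> /= /hD.
Qed.

Lemma resolves_quoS (D D' : S -> Prop) F :
  (forall f, D f <-> D' f) -> resolves (quoS D) F -> resolves (quoS D') F.
Proof. exact: (@resolves_ext (fun _ => True) (fun _ => True)). Qed.

(** [S] in degree 0 alone: the Koszul complex of the empty sequence, on which the iterated cones are
    built. *)
Definition unit_cpx : gcomplex k n 1 :=
  @GComplex k n 1 (fun i => if i is 0 then 1 else 0)%N (fun _ _ => 0)
    (fun _ => 0) 1%:M.

Lemma unit_cpx_resolves : resolves (quoS (fun f : S => f = 0)) unit_cpx.
Proof.
split=> [|v|i v] /=.
- by split=> // u _; exists u; rewrite mulmx1 subrr mxE.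
- rewrite mulmx1; split=> [E|[w ->]]; last by rewrite mulmx0 mxE.
  by exists 0; rewrite mul0mx; apply/rowP => j; rewrite ord1 E mxE.
- split=> _; last by rewrite mulmx0.
  by exists 0; rewrite [v]thinmx0 [RHS]thinmx0.
Qed.

Lemma unit_cpx_homogeneous :
  homogeneous_cpx unit_cpx /\ homogeneous_mx (csh unit_cpx 0) (fun _ => 0)
    (caug unit_cpx).
Proof.
split=> [i a b|a b] /=; first by rewrite mxE; apply: homogeneous_of0.
rewrite mxE !ord1 eqxx subr0 => m; rewrite msupp1 inE => /eqP ->.
by rewrite mdeg0.
Qed.

Section ConeHomogeneous.
Variables (m1 m2 : nat) (X : gcomplex k n m1) (Y : gcomplex k n m2) (delta :
  int).
Variable phi : forall i, 'M[S]_(crk X i, crk Y i).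

Lemma cone_homogeneous m3 (R : 'M[S]_(m2, m3)) :
  homogeneous_cpx X -> homogeneous_cpx Y ->
  (forall i, homogeneous_mx (fun a => csh X i a + delta) (csh Y i) (phi i)) ->
  homogeneous_cpx (cone delta phi R).
Proof.
move=> hX hY hphi [|i] a b /=; rewrite mxE.
  by case: splitP => c _; [apply: hY | apply: hphi].
case: (split a) => c; rewrite mxE; case: (split b) => d.
- exact: hY.
- by rewrite mxE; apply: homogeneous_of0.
- exact: hphi.
- rewrite mxE [csh X i d + _]addrC addrKA; apply: homogeneous_ofN; exact: hX.
Qed.
End ConeHomogeneous.

(** Exactness of 0 -> S/(I : x^u) -> S/I -> S/(I, x^u) -> 0, where I is the ideal of [Q] and the
    first map is multiplication by x^u. *)
Lemma cone_quoS Q (u : 'X_{1..n}) delta X Y phi :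
  upward Q ->
  resolves (quoS (@monid k n (fun m => Q (u + m)%MM))) X ->
  resolves (quoS (@monid k n Q)) Y ->
  lifts (quoS (@monid k n Q)) X Y ('X_[u])%:M phi ->
  resolves (quoS (@monid k n (fun m => (u <= m)%MM || Q m)))
    (@cone k n 1 1 1 delta X Y phi 1%:M).
Proof.
move=> uQ rX rY lphi.
have uQ' : upward (fun m => (u <= m)%MM || Q m).
  move=> m m' /orP [h|/uQ ->]; last by rewrite orbT.
  by rewrite (lepm_trans h) ?lem_addr.
refine (@cone_resolves k n (quoS (monid (fun m => Q (u + m)%MM)))
          (quoS (monid Q)) (quoS (monid (fun m => (u <= m)%MM || Q m)))
          delta X Y phi ('X_[u])%:M 1%:M _ _ _ _ rX rY lphi _ _ _ _ _) => //=.
- exact: monid_submod.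
- exact: monid_submod.
- by move=> v _; exists v => //; rewrite mulmx1 subrr mxE; apply: monid0.
- move=> v _; rewrite mulmx1; split.
    (* Terms divisible by x^u are split off; the others lie in the ideal of [Q] and get the trivial
       factor, with exponent 0. *)
    move=> hv; have [|f1 [f2 [_ hf2 E]]] := @monid_split k n predT Q u 0%MM (v
      0 0).
      move=> m /hv /orP [->//|h]; apply/orP; right.
      by rewrite subm0 h andbT; apply/mnm_lepP => i; rewrite mnm0E.
    exists (const_mx f1) => //.
    rewrite mul_mx_scalar !mxE E addrC addKr mpolyX0 mul1r //.
  case=> w _; rewrite mul_mx_scalar => h.
  rewrite -[v](subrK ('X_[u] *: w)) mxE; apply: monidD.
    by move=> m /h ->; rewrite orbT.
  by rewrite mxE; apply/monidMX => m _; rewrite lem_addr.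
- by move=> v; rewrite mul_mx_scalar mxE monidMX.
- by move=> v _; rewrite mul_mx_scalar mxE monidMX.
Qed.

Definition dvd_some s : pred 'X_{1..n} := fun m => has (fun g => (g <= m)%MM) s.

Lemma dvd_some_upward s : upward (dvd_some s).
Proof.
move=> m m' /hasP [g gs le]; apply/hasP; exists g => //.
by apply: (lepm_trans le); apply: lem_addr.
Qed.

(** Subtraction is truncated, so [g - u] is the exponent of g/gcd(g, u); these monomials generate
    the colon ideal by x^u. *)
Lemma lem_sub_add (g u m : 'X_{1..n}) : (g - u <= m)%MM = (g <= u + m)%MM.
Proof.
by apply/mnm_lepP/mnm_lepP => h i; move: (h i); rewrite mnmBE mnmDE leq_subLR.
Qed.

(* Iterated cones over S/(I : u)(- deg u) -> S/I: Taylor's resolution. *)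
Lemma monomial_resolution c s : all (fun g => mdeg g <= c)%N s ->
  exists F : gcomplex k n 1,
    [/\ resolves (quoS (@monid k n (dvd_some s))) F, homogeneous_cpx F,
        homogeneous_mx (csh F 0) (fun _ => 0) (caug F)
      & forall i a, csh F i a <= (c * i)%N%:Z].
Proof.
have [N] := ubnP (size s); elim: N s => // N IH [_ _|u s /= sN /andP [du ds]].
  have [h1 h2] := unit_cpx_homogeneous.
  exists unit_cpx; split=> //.
  apply: resolves_quoS unit_cpx_resolves => f.
  split=> [->|hf]; first exact: monid0.
  by apply/mpolyP => m; rewrite mcoeff0; apply/eqP; apply/negP => /negP /hf.
have [|Y [rY hY haY dY]] := IH s _ ds; first by [].
have [| |X [rX hX haX dX]] := IH [seq (g - u)%MM | g <- s].
- by rewrite size_map.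
- rewrite all_map; apply: sub_all ds => g /= h; exact: leq_trans (mdegB _ _) h.
have cX := resolves_complex rX.
have {}rX : resolves (quoS (@monid k n (fun m => dvd_some s (u + m)%MM))) X.
  apply: resolves_quoS rX => // f; apply: eq_monid => m.
  by rewrite /dvd_some has_map; apply: eq_has => g /=; rewrite lem_sub_add.
have sY : submod (@den _ _ (quoS (@monid k n (dvd_some s)))).
  apply: monid_submod; exact: dvd_some_upward.
have [//|w|phi lphi] := @comparison k n 1 (quoS (monid (dvd_some s))) X Y
  ('X_[u])%:M sY cX _ _ rY.
  rewrite mul_mx_scalar /= mxE; apply/monidMX.
  exact: (resolves_den rX w).
have [|psi lpsi hpsi] := graded_lift (d := (mdeg u)%:Z) sY (@monid_hcomp _ _ _)
  hX haX hY haY _ lphi.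
  by rewrite mxE eqxx => m; rewrite msuppX inE => /eqP ->.
exists (cone (mdeg u)%:Z psi 1%:M); split.
- exact: (cone_quoS _ (@dvd_some_upward s) rX rY lpsi).
- exact: cone_homogeneous.
- by rewrite /= mulmx1.
- move=> [|i] a /=; first exact: dY.
  case: (split a) => b; first exact: dY.
  (* A generator from [X] gains the degree of [u], at most [c], while its homological degree grows
     by 1. *)
  by rewrite mulnSr PoszD; apply: lerD; [apply: dX | rewrite lez_nat].
Qed.

(** * Koszul complexes of coprime monomials *)

Definition coprimem (u v : 'X_{1..n}) := [forall i, (u i == 0%N) || (v i ==
  0%N)].

Fixpoint koszul s : gcomplex k n 1 :=
  if s is u :: s' then
    @cone k n 1 1 1 (mdeg u)%:Z (koszul s') (koszul s') (fun i => ('X_[u])%:M)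
      1%:M
  else unit_cpx.

(** As [u] is coprime to the later monomials, the colon by it leaves their ideal unchanged, so the
    cone is that of multiplication by x^u on one complex. *)
Lemma koszul_resolves s : pairwise coprimem s ->
  resolves (quoS (@monid k n (dvd_some s))) (koszul s).
Proof.
elim: s => [_|u s IH /= /andP [cu cs]].
  apply: resolves_quoS unit_cpx_resolves => f.
  split=> [->|hf]; first exact: monid0.
  by apply/mpolyP => m; rewrite mcoeff0; apply/eqP; apply/negP => /negP /hf.
have rK := IH cs.
apply: (cone_quoS _ (@dvd_some_upward s)) => //.
  apply: resolves_quoS rK => // f; apply: eq_monid => m.
  apply: eq_in_has => g gs; move/allP: cu => /(_ g gs) /forallP cg.
  apply/mnm_lepP/mnm_lepP => h i; move: (h i) (cg i); rewrite mnmDE; lia.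
split=> [i|v]; first by rewrite scalar_mxC.
rewrite scalar_mxC subrr mulmx0 /= mxE; exact: monid0.
Qed.

Lemma koszul_homogeneous s : homogeneous_cpx (koszul s) /\
  homogeneous_mx (csh (koszul s) 0) (fun _ => 0) (caug (koszul s)).
Proof.
elim: s => [|u s [h1 h2]]; first exact: unit_cpx_homogeneous.
split; last by rewrite /= mulmx1.
apply: cone_homogeneous => // i a b; rewrite mxE.
have [->|_] := eqVneq a b; last exact: homogeneous_of0.
by rewrite addrC addKr => m; rewrite msuppX inE => /eqP ->.
Qed.

(** All entries of the differentials are 0 or, up to sign, nonconstant monomials from [s]. *)
Lemma koszul_minimal s i : all (fun u => u != 0%MM) s -> cdk (koszul s) i = 0.
Proof.
elim: s i => [i _|u s IH i /= /andP [u0 hs]].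
  by rewrite /cdk /= map_mx0.
have hu j : map_mx (mcoeff 0%MM) (('X_[u])%:M : 'M[S]_j) = 0.
  rewrite map_scalar_mx /= mcoeffX (negPf u0).
  by apply/matrixP => a b; rewrite !mxE mul0rn.
rewrite /cdk; case: i => [|i] /=.
  by rewrite map_col_mx hu -[map_mx _ _]/(cdk _ _) IH // col_mx0.
rewrite map_block_mx hu map_mxN map_mx0 -![map_mx _ (cd _ _)]/(cdk _ _) !IH //.
by rewrite oppr0 block_mx0.
Qed.

(** The generator is the exterior product of all basis elements. *)
Lemma koszul_top s :
  exists a, csh (koszul s) (size s) a = (\sum_(u <- s) mdeg u)%N%:Z.
Proof.
elim: s => [|u s [a Ea]]; first by exists 0; rewrite big_nil.
exists (rshift _ a); rewrite /= (unsplitK (inr a)) Ea big_cons.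
by rewrite addnC PoszD.
Qed.

(** [rho] is a retraction in each degree separately, without a condition on differentials; it shows
    that [iota] stays injective over [k]. *)
Lemma koszul_incl t s :
  exists iota (rho : forall i, 'M[S]_(crk (koszul (t ++ s)) i, crk (koszul s)
    i)),
    [/\ chain_map (koszul s) (koszul (t ++ s)) iota,
        iota 0%N *m caug (koszul (t ++ s)) = caug (koszul s)
      & forall i, iota i *m rho i = 1%:M].
Proof.
elim: t => [|u t [iota [rho [ci ai hi]]]].
  exists (fun i => 1%:M), (fun i => 1%:M).
  by split=> [i|//|i]; rewrite ?mulmx1 ?mul1mx.
pose j i : 'M[S]_(crk (koszul (t ++ s)) i, crk (koszul ((u :: t) ++ s)) i) :=
  match i with 0 => 1%:M | i'.+1 => row_mx 1%:M 0 end.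
pose r i : 'M[S]_(crk (koszul ((u :: t) ++ s)) i, crk (koszul (t ++ s)) i) :=
  match i with 0 => 1%:M | i'.+1 => col_mx 1%:M 0 end.
have jr i : j i *m r i = 1%:M.
  by case: i => [|i] /=; rewrite ?mulmx1 // mul_row_col mulmx1 mulmx0 addr0.
have cj : chain_map (koszul (t ++ s)) (koszul ((u :: t) ++ s)) j.
  case=> [|i] /=.
    by rewrite mul_row_col mul0mx mul1mx addr0 mulmx1.
  by rewrite mul_row_block !mul0mx !mul1mx !addr0 mul_mx_row mulmx1 mulmx0.
exists (fun i => iota i *m j i), (fun i => r i *m rho i); split=> [i||i].
- by rewrite -mulmxA cj mulmxA ci mulmxA.
- by rewrite /= !mulmx1.
- by rewrite -mulmxA [j i *m _]mulmxA jr mul1mx.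
Qed.

End MonomialResolutions.

Arguments coprimem {n} u v.

(** * Graded Betti numbers *)

Section Betti.
Variables (k : fieldType) (n : nat).
Local Notation S := {mpoly k[n]}.
Implicit Types (s t : seq 'X_{1..n}) (Q : pred 'X_{1..n}).

(** Taylor's resolution shows that a graded free resolution exists, so the value chosen by [epsilon]
    is one. *)
Lemma resolution_monid s :
  let F := resolution (quoS (@monid k n (dvd_some s))) in
  [/\ resolves (quoS (@monid k n (dvd_some s))) F, homogeneous_cpx F &
      homogeneous_mx (csh F 0) (fun _ => 0) (caug F)].
Proof.
move=> F.
have [|G [[h1 h2 h3] hG aG _]] :=
    @monomial_resolution k n (\max_(g <- s) mdeg g) s.
  by apply/allP => g gs; rewrite (big_rem g) //= leq_maxl.
have : graded_free_resolution F.
  by apply: epsilon_spec; exists G; split.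
by case=> *; split.
Qed.

Section Tor.
Variables (m : nat) (F : gcomplex k n m).
Hypotheses (cF : complex F) (hF : homogeneous_cpx F).

Lemma cdk_complex i : cdk F i.+1 *m cdk F i = 0.
Proof. by rewrite -map_mxM cF map_mx0. Qed.

(** A nonzero constant term forces the prescribed degree [s a - t b] of the entry to be 0. *)
Lemma homogeneous_const p q (s : 'I_p -> int) (t : 'I_q -> int)
    (A : 'M[S]_(p, q)) a b :
  homogeneous_mx s t A -> map_mx (mcoeff 0%MM) A a b != 0 -> s a = t b.
Proof.
move=> hA; rewrite mxE -mcoeff_msupp => /hA.
by rewrite mdeg0 => /esym/eqP; rewrite subr_eq0 => /eqP.
Qed.

Lemma homogeneous_degpart p q (s : 'I_p -> int) (t : 'I_q -> int)
    (A : 'M[S]_(p, q)) (j : int) :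
  homogeneous_mx s t A ->
  diag_mx (\row_a (s a == j)%:R) *m map_mx (mcoeff 0%MM) A =
  map_mx (mcoeff 0%MM) A *m diag_mx (\row_a (t a == j)%:R).
Proof.
move=> hA; rewrite mul_diag_mx mul_mx_diag; apply/matrixP => a b.
rewrite [LHS]mxE [RHS]mxE ![(\row__ _) _ _]mxE.
have [->|/(homogeneous_const hA) ->] := eqVneq (map_mx (mcoeff 0%MM) A a b) 0.
  by rewrite mulr0 mul0r.
exact: mulrC.
Qed.

Lemma degpart_id i j (z : 'rV_(crk F i)) :
  (z <= degpart F i j)%MS <-> z *m degpart F i j = z.
Proof.
split=> [/submxP [w ->]|<-]; last exact: submxMl.
rewrite -mulmxA; congr (_ *m _); rewrite /degpart mul_diag_mx.
apply/matrixP => a b; rewrite !mxE; case: (_ == j); rewrite ?mul1r ?mul0r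
  ?mul0rn //.
Qed.

Definition cycle i : 'rV[k]_(crk F i) -> Prop :=
  match i with
  | 0 => fun _ => True
  | i'.+1 => fun z => z *m cdk F i' = 0
  end.

Lemma cyclesP i (z : 'rV_(crk F i)) : (z <= cycles F i)%MS <-> cycle z.
Proof.
case: i z => [|i] z /=; first by rewrite submx1.
by split=> /sub_kermxP.
Qed.

(** Boundaries of degree [j] are cycles of degree [j], so the ranks differ exactly when this
    inclusion is strict; a cycle of degree [j] that bounds also bounds an element of degree [j], by
    projection. *)
Lemma homology_neq0 i j :
  (\rank (cycles F i :&: degpart F i j)%MS
     - \rank (degpart F i.+1 j *m cdk F i) <> 0)%N <->
  exists z : 'rV_(crk F i), [/\ cycle z, z *m degpart F i j = z
                             & forall w, z <> w *m cdk F i].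
Proof.
have comm : degpart F i.+1 j *m cdk F i = cdk F i *m degpart F i j.
  exact: homogeneous_degpart.
split=> [h|[z [cz dz nz]]].
  have : ~~ (cycles F i :&: degpart F i j <= degpart F i.+1 j *m cdk F i)%MS.
    by apply/negP => /mxrankS; rewrite -subn_eq0 => /eqP.
  case/row_subPn => a ha.
  have := row_sub a (cycles F i :&: degpart F i j)%MS.
  move: ha; set z := row a _ => nz; rewrite sub_capmx => /andP [/cyclesP cz
    /degpart_id dz].
  exists z; split=> // w E; case/negP: nz.
  by rewrite -dz E -mulmxA -comm mulmxA -mulmxA submxMl.
have sub : (degpart F i.+1 j *m cdk F i <= cycles F i :&: degpart F i j)%MS.
  rewrite sub_capmx {2}comm submxMl andbT.
  apply/row_subP => a; apply/cyclesP.
  rewrite row_mul; case: (i) (row a _) => //= i' w.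
  by rewrite -mulmxA cdk_complex mulmx0.
have lt : (degpart F i.+1 j *m cdk F i < cycles F i :&: degpart F i j)%MS.
  rewrite /ltmx sub /=; apply/negP => sub'.
  have /submxP [w E] : (z <= degpart F i.+1 j *m cdk F i)%MS.
    apply: submx_trans sub'; rewrite sub_capmx.
    by apply/andP; split; [apply/cyclesP | apply/degpart_id].
  by apply: (nz (w *m degpart F i.+1 j)); rewrite -mulmxA.
by move: lt; rewrite ltmxErank => /andP [_]; rewrite -subn_gt0; case: (_ - _)%N.
Qed.
End Tor.

Local Notation "A ^k" := (map_mx (mcoeff 0%MM) A) (at level 2).

(** The homotopy reduces modulo the variables, and its term [cd F i *m h i] vanishes on cycles. *)
Lemma null_homotopic_cycle m M' (F : gcomplex k n m)
    (G : gcomplex k n (grk M')) (phi : forall i, 'M[S]_(crk F i, crk G i)) i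
    (z : 'rV_(crk F i)) :
  complex F -> resolves M' G -> chain_map F G phi ->
  (forall v, @den _ _ M' (v *m phi 0%N *m caug G)) -> cycle z ->
  exists w, z *m (phi i)^k = w *m cdk G i.
Proof.
move=> cF rG cphi aphi cz.
have [h [h0 hS]] := null_homotopic cF rG cphi aphi.
case: i z cz => [|i] z cz.
  by exists (z *m (h 0%N)^k); rewrite h0 map_mxM mulmxA.
exists (z *m (h i.+1)^k).
rewrite hS map_mxD !map_mxM mulmxDr !mulmxA -/(cdk F i) cz mul0mx addr0.
by [].
Qed.

(** * Betti numbers of quotients by monomial ideals *)

Section BettiMonid.
Variable s : seq 'X_{1..n}.
Local Notation I := (@monid k n (dvd_some s)).
Local Notation M := (quoS I).

Lemma sI : submod (@den _ _ M).
Proof. apply: monid_submod; exact: dvd_some_upward. Qed.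

(** The identity of a resolution factors up to homotopy through Taylor's, which in homological
    degree [i] has no generator of degree above [c * i]; a cycle of larger degree is thus a
    boundary. *)
Lemma betti_le c i j : all (fun g => mdeg g <= c)%N s ->
  betti M i j <> 0%N -> j <= (c * i)%N%:Z.
Proof.
move=> hs; have [rF hF aF] := resolution_monid s.
set F := resolution M in rF hF aF.
have [T [rT hT aT dT]] := monomial_resolution k hs.
have cF := resolves_complex rF; have cT := resolves_complex rT.
move/(homology_neq0 cF hF) => [z [cz dz nz]].
have lid (F' G : gcomplex k n 1) : resolves M F' -> resolves M G ->
    exists phi, lifts M F' G 1%:M phi.
  move=> rF' rG; apply: (comparison (M' := M) sI (resolves_complex rF') _ _ rG)
    => //.
  by move=> w; rewrite mulmx1; apply: (resolves_den rF').
have [beta [cbeta abeta]] := lid T F rT rF.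
have [alpha0 l0] := lid F T rF rT.
have [|alpha [calpha aalpha] halpha] := graded_lift (d := 0) sI (@monid_hcomp _
  _ _) hF aF hT aT _ l0.
  by rewrite mxE eqxx => m; rewrite msupp1 inE => /eqP ->; rewrite mdeg0.
rewrite leNgt; apply/negP => lt.
(* [alpha] preserves degrees and [T] has no generator of degree [j] here, so [z] is killed. *)
have za : z *m (alpha i)^k = 0.
  rewrite -dz -mulmxA.
  have -> : degpart F i j *m (alpha i)^k =
     (alpha i)^k *m diag_mx (\row_a (csh T i a == j)%:R).
    apply: homogeneous_degpart => a b.
    by rewrite -[csh F i a]addr0; apply: halpha.
  rewrite [X in diag_mx X](_ : _ = 0) ?linear0 ?mulmx0 //.
  apply/rowP => a; rewrite !mxE; case: eqP => // E.
  by move: lt; rewrite -E ltNge dT.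
(* This map lifts zero, while over [k] it sends [z] to its negative. *)
pose phi i := alpha i *m beta i - 1%:M.
have [|v|w E] := @null_homotopic_cycle _ M F F phi i z cF rF _ _ cz.
- move=> i'; rewrite /phi mulmxBl mulmxBr mul1mx mulmx1; congr (_ - _).
  by rewrite -mulmxA cbeta !mulmxA calpha.
- have -> : v *m phi 0%N *m caug F =
      - (v *m (caug F *m 1%:M - alpha 0%N *m caug T))
      - ((v *m alpha 0%N) *m (caug T *m 1%:M - beta 0%N *m caug F)).
    rewrite /phi !mulmx1 !mulmxBr !mulmxBl mulmx1 !mulmxA opprB opprB.
    by rewrite [RHS]addrC addrA subrK.
  by apply: (submodB sI); [apply: (submodN sI)|].
apply: (nz (- w)); rewrite mulNmx -E /phi map_mxB map_mxM map_mx1.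
by rewrite mulmxBr mulmx1 mulmxA za mul0mx sub0r opprK.
Qed.

(* The inclusion of koszul u into koszul (t ++ u) factors through F up to
   homotopy, and vanishing differentials over k turn this into an equality. *)
Lemma betti_koszul t u :
  pairwise coprimem (t ++ u) -> all (fun g => g != 0%MM) (t ++ u) ->
  (forall m, dvd_some u m -> dvd_some s m) ->
  (forall m, dvd_some s m -> dvd_some (t ++ u) m) ->
  betti M (size u) (\sum_(g <- u) mdeg g)%N%:Z <> 0%N.
Proof.
move=> cop nu us su; have [rF hF aF] := resolution_monid s.
set F := resolution M in rF hF aF.
have cF := resolves_complex rF.
have copu : pairwise coprimem u by move: cop; rewrite pairwise_cat => /and3P [].
have nu' : all (fun g => g != 0%MM) u by move: nu; rewrite all_cat => /andP [].
have rK := koszul_resolves k copu; have rK' := koszul_resolves k cop.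
have [hK aK] := koszul_homogeneous k u.
set K := koszul k u in rK hK aK; set K' := koszul k (t ++ u) in rK'.
have cK := resolves_complex rK.
set M' := quoS (monid (dvd_some (t ++ u))) in rK'.
have sM' : submod (@den _ _ M') by apply: monid_submod; exact: dvd_some_upward.
have [//|w|psi0 l0] := comparison (M' := M) (P := 1%:M) sI cK _ _ rF.
  rewrite mulmx1 => m hm; apply: us; exact: (resolves_den rK w).
have [|psi [cpsi apsi] hpsi] := graded_lift (d := 0) sI (@monid_hcomp _ _ _) hK
  aK hF aF _ l0.
  by rewrite mxE eqxx => m; rewrite msupp1 inE => /eqP ->; rewrite mdeg0.
have [//|w|phi [cphi aphi]] := comparison (M' := M') (P := 1%:M) sM' cF _ _ rK'.
  rewrite mulmx1 => m hm; apply: su; exact: (resolves_den rF w).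
have [iota [rho [ciota aiota hiota]]] := koszul_incl k t u.
have [a Ea] := koszul_top k u.
apply/(homology_neq0 cF hF); set i := size u in a Ea *; set j := (\sum_(g <- u)
  mdeg g)%N%:Z in Ea *.
pose z0 : 'rV[k]_(crk K i) := delta_mx 0 a.
(* The image in [F] of the top Koszul generator; it is a cycle because the differentials of [K]
   vanish over [k]. *)
exists (z0 *m (psi i)^k); split.
- case: (i) z0 => //= i' z0.
  by rewrite -mulmxA -map_mxM cpsi map_mxM mulmxA -/(cdk K i') koszul_minimal
    // mulmx0 mul0mx.
- rewrite -mulmxA.
  have <- : degpart K i j *m (psi i)^k = (psi i)^k *m degpart F i j.
    apply: homogeneous_degpart => b c.
    by rewrite -[csh K i b]addr0; apply: hpsi.
  rewrite mulmxA; congr (_ *m _).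
  rewrite mul_mx_diag; apply/rowP => b; rewrite !mxE.
  have [->|_] := eqVneq b a; first by rewrite Ea !eqxx mulr1.
  by rewrite andbF mul0r.
move=> w E.
(* The composite through [F] and the inclusion [iota] both lift the projection S/(u) -> S/(t, u). *)
pose chi i := psi i *m phi i - iota i.
have cz i' (z : 'rV_(crk K i')) : cycle z.
  by case: i' z => //= i' z; rewrite koszul_minimal ?mulmx0.
have [|v|w' E'] := @null_homotopic_cycle _ M' K K' chi i z0 cK rK' _ _ (cz i
  z0).
- move=> i'; rewrite /chi mulmxBl mulmxBr ciota; congr (_ - _).
  by rewrite -mulmxA cphi !mulmxA cpsi.
- have -> : v *m chi 0%N *m caug K' =
      - (v *m (caug K *m 1%:M - psi 0%N *m caug F))
      - ((v *m psi 0%N) *m (caug F *m 1%:M - phi 0%N *m caug K')).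
    rewrite /chi !mulmx1 !mulmxBr !mulmxBl -[v *m iota _ *m _]mulmxA aiota
      !mulmxA opprB opprB.
    by rewrite [RHS]addrC addrA subrK.
  apply: (submodB sM') => //; apply: (submodN sM') => m hm; apply: su; exact:
    apsi hm.
(* A boundary in [F] maps to a boundary in [K'], which is 0 over [k] by minimality, and so is the
   homotopy term. Hence [iota] kills [z0], contrary to [rho]. *)
have : z0 *m (iota i)^k = 0.
  apply/eqP; rewrite -oppr_eq0; apply/eqP.
  move: E'; rewrite koszul_minimal // mulmx0 map_mxB map_mxM mulmxBr mulmxA E.
  rewrite -mulmxA -map_mxM -cphi map_mxM -/(cdk K' i) koszul_minimal // mulmx0
    mulmx0.
  by rewrite sub0r.
move/(congr1 (mulmx^~ (rho i)^k)); rewrite mul0mx -mulmxA -map_mxM hiota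
  map_mx1 mulmx1.
by move/rowP/(_ a); rewrite !mxE !eqxx => /eqP; rewrite oner_eq0.
Qed.

End BettiMonid.
End Betti.

(** * Krull dimension *)

Section Krull.
Variables (k : fieldType) (n : nat).
Local Notation S := {mpoly k[n]}.
Implicit Types (P : S -> Prop).

Lemma prime_sum P (T : Type) (r : seq T) (Q : pred T) (F : T -> S) :
  prime_ideal P -> (forall x, Q x -> P (F x)) -> P (\sum_(x <- r | Q x) F x).
Proof. by case=> h0 hA _ _ _ hF; elim/big_ind: _. Qed.

Lemma primeMr P f g : prime_ideal P -> P f -> P (f * g).
Proof. by case=> _ _ hM _ _ hf; rewrite mulrC; apply: hM. Qed.

Lemma primeB P f g : prime_ideal P -> P f -> P g -> P (f - g).
Proof.
by case=> _ hA hM _ _ hf hg; apply: hA => //; rewrite -mulN1r; apply: hM.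
Qed.

Lemma prime_expX P f a : prime_ideal P -> P (f ^+ a) -> P f.
Proof.
case=> _ _ _ h1 hp; elim: a => [/h1 //|a IH].
by rewrite exprS => /hp [].
Qed.

Lemma prime_prod P (T : eqType) (r : seq T) (F : T -> S) :
  prime_ideal P -> P (\prod_(x <- r) F x) -> exists2 x, x \in r & P (F x).
Proof.
move=> pP; case: (pP) => _ _ _ h1 hp; elim: r => [|x r IH].
  by rewrite big_nil => /h1.
rewrite big_cons => /hp [hx|/IH [y yr hy]].
  by exists x => //; rewrite mem_head.
by exists y => //; rewrite in_cons yr orbT.
Qed.

Section Chain.
Variables (m D : nat) (p : nat -> S -> Prop) (f : nat -> S).
Hypothesis prime_p : forall i, (i <= m)%N -> prime_ideal (p i).
Hypothesis mono_p : forall i g, (i < m)%N -> p i g -> p i.+1 g.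
Hypothesis in_p : forall i, (i < m)%N -> p i.+1 (f i).
Hypothesis notin_p : forall i, (i < m)%N -> ~ p i (f i).
Local Notation T := {ffun 'I_m -> 'I_D.+1}.

(* Divide by the least power of [f j] and reduce modulo [p j.+1]. *)
Lemma chain_independent (v : T -> k) j (E : {set T}) :
  (j <= m)%N -> E != set0 -> (forall a, a \in E -> v a != 0) ->
  (forall a b (i : 'I_m), a \in E -> b \in E -> (i < j)%N -> a i = b i) ->
  ~ p j (\sum_(a in E) v a *: \prod_(i < m | (j <= i)%N) f i ^+ a i).
Proof.
have [N] := ubnP (m - j)%N; elim: N j E => // N IH j E.
rewrite ltnS => leN ljm /set0Pn [a0 Ea0] hv agree.
(* When [j = m] all exponents are fixed, so the sum is a single nonzero constant. *)
have [mj|ltj] := leqP m j.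
  have Ej : j = m by apply/eqP; rewrite eqn_leq ljm mj.
  have E1 a : a \in E -> a = a0.
    by move=> Ea; apply/ffunP => i; apply: agree; rewrite // Ej ltn_ord.
  rewrite (bigD1 a0) //= [X in _ + X]big1 ?addr0; last first.
    by move=> a /andP [/E1 ->]; rewrite eqxx.
  rewrite big1 => [hp|i]; last by rewrite leqNgt Ej ltn_ord.
  case: (prime_p ljm) => _ _ hM h1 _; apply: h1.
  have := hM (v a0)^-1%:MP _ hp.
  by rewrite mul_mpolyC scalerA mulVf ?hv // scale1r.
pose j' := Ordinal ltj.
case: (@arg_minnP _ a0 (fun a => a \in E) (fun a => a j' : nat) Ea0) => a1 Ea1
  min1.
set c := nat_of_ord (a1 j') in min1.
pose F (a : T) := \prod_(i < m | (j.+1 <= i)%N) f i ^+ a i.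
have split_j (a : T) : \prod_(i < m | (j <= i)%N) f i ^+ a i = f j ^+ a j' * F
  a.
  rewrite (bigD1 j') //=; congr (_ * _); apply: eq_bigl => i.
  by rewrite ltn_neqAle eq_sym andbC.
pose E' := [set a in E | a j' == a1 j'].
(* The least exponent [c] of [f j] is attained exactly on [E']; from the remaining terms one more
   factor [f j] splits off. *)
have -> : \sum_(a in E) v a *: \prod_(i < m | (j <= i)%N) f i ^+ a i =
    f j ^+ c * (\sum_(a in E') v a *: F a +
                f j * \sum_(a in E | a \notin E') v a *: (f j ^+ (a j' - c.+1)
                  * F a)).
  rewrite mulrDr mulrA -exprSr !mulr_sumr (bigID (mem E')) /=; congr (_ + _).
    apply: eq_big => a; first by rewrite !inE andbA andbb.
    rewrite !inE andbA andbb => /andP [_ /eqP Ea].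
    by rewrite split_j Ea scalerAr.
  apply: eq_bigr => a /andP [Ea]; rewrite inE Ea /= => ne.
  have lt : (c < a j')%N.
    rewrite ltn_neqAle min1 // andbT; apply: contraNneq ne => E1.
    by apply/eqP/val_inj.
  by rewrite split_j -scalerAr mulrA -exprD subnKC.
have pj := prime_p ljm; case: (pj) => _ _ _ _ hp.
move/hp => [/(prime_expX pj)|]; first exact: notin_p.
move/(mono_p ltj); set g := f j * _ => h.
have pj' : prime_ideal (p j.+1) by apply: prime_p.
have hg : p j.+1 g by apply: primeMr => //; apply: in_p.
have := primeB pj' h hg; rewrite addrK; apply: IH => //; first lia.
- by apply/set0Pn; exists a1; rewrite inE Ea1 eqxx.
- by move=> a; rewrite inE => /andP [/hv].
- move=> a b i; rewrite !inE => /andP [Ea /eqP aj] /andP [Eb /eqP bj].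
  rewrite ltnS leq_eqVlt => /orP [/eqP ij|]; last exact: agree.
  by rewrite (_ : i = j') ?aj ?bj //; apply: val_inj.
Qed.

End Chain.

Definition degle (b : nat) (g : S) := forall m, m \in msupp g -> (mdeg m <=
  b)%N.

Lemma degleM a b f g : degle a f -> degle b g -> degle (a + b) (f * g).
Proof.
move=> hf hg m /msuppM_le /allpairsP [[m1 m2] /= [/hf h1 /hg h2 ->]].
by rewrite mdegD leq_add.
Qed.

Lemma degle1 : degle 0 1.
Proof. by move=> m; rewrite msupp1 inE => /eqP ->; rewrite mdeg0. Qed.

Lemma degle_exp b f a : degle b f -> degle (a * b) (f ^+ a).
Proof.
move=> hf; elim: a => [|a IH]; first exact: degle1.
by rewrite exprS mulSn; apply: degleM.
Qed.

Lemma degle_le a b f : (a <= b)%N -> degle a f -> degle b f.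
Proof. by move=> le hf m /hf h; apply: leq_trans le. Qed.

Lemma degle_prod m (F : 'I_m -> S) b :
  (forall i, degle b (F i)) -> degle (m * b) (\prod_i F i).
Proof.
elim: m F => [|m IH] F hF; first by rewrite big_ord0; apply: degle1.
by rewrite big_ord_recl mulSn; apply: degleM => //; apply: IH.
Qed.

(* A chain longer than n - #|A| would give n - #|A| + 1 elements; their
   monomials with exponents at most D outnumber the monomials in the variables
   outside A that can occur in them, hence satisfy a linear relation mod p 0. *)
Lemma krull_bound (A : {set 'I_n}) (p : nat -> S -> Prop) t :
  (forall i, (i <= t)%N -> prime_ideal (p i)) ->
  (forall i, i \in A -> p 0%N 'X_i) ->
  (forall i, (i < t)%N ->
     (forall f, p i f -> p i.+1 f) /\ (exists f, p i.+1 f /\ ~ p i f)) ->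
  (t <= #|~: A|)%N.
Proof.
move=> prime_p pA chain; rewrite leqNgt; apply/negP => lt.
set d := #|~: A| in lt.
have hex (i : 'I_d.+1) : exists g, p i.+1 g /\ ~ p i g.
  have := ltn_ord i => li.
  by have [//|_ [g hg]] := chain i; [lia | exists g].
have [f hf] := fin_all_exists hex.
pose c := (\max_i msize (f i))%N.
have hc i : degle c (f i).
  move=> m /msize_mdeg_lt h; apply: leq_trans (leq_bigmax i); exact: ltnW.
(* Chosen so that (D + 1)^(d + 1) exceeds (B + 1)^d: B + 1 is at most (D + 1)((d + 1)c + 1), whose
   [d]-th power is (D + 1)^d D. *)
pose D := ((d.+1 * c).+1 ^ d)%N.
pose B := (d.+1 * (D * c))%N.
pose T := {ffun 'I_d.+1 -> 'I_D.+1}.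
pose U := {ffun {i : 'I_n | i \notin A} -> 'I_B.+1}.
have ltUT : (#|{: U}| < #|{: T}|)%N.
  rewrite !card_ffun !card_ord card_sig.
  have -> : #|[pred i | i \notin A]| = d.
    by apply: eq_card => i; rewrite !inE.
  have expW a b q : (a <= b -> a ^ q <= b ^ q)%N.
    by case: q => // q h; rewrite leq_exp2r.
  apply: (@leq_ltn_trans ((D.+1 * (d.+1 * c).+1) ^ d)).
    have le : (B.+1 <= D.+1 * (d.+1 * c).+1)%N by rewrite /B; nia.
    exact: expW.
  by rewrite expnMn expnS mulnC ltn_pmul2r ?expn_gt0.
pose fe (a : T) := \prod_(i < d.+1) f i ^+ a i.
have hfe a : degle B (fe a).
  apply: degle_prod => i; apply: (@degle_le (a i * c)); last exact: degle_exp.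
  by rewrite leq_mul2r -ltnS ltn_ord orbT.
pose mu (b : U) : 'X_{1..n} :=
  [multinom (if insub i is Some x then b x : nat else 0%N) | i < n].
pose X : 'M[k]_(#|{: T}|, #|{: U}|) :=
  \matrix_(a, b) (fe (enum_val a))@_(mu (enum_val b)).
(* There are more exponent vectors [a] than exponents [mu b], so a nontrivial combination of the
   [fe a] has no term [mu b]. *)
have [v vX v0] : exists2 v : 'rV_#|{: T}|, v *m X = 0 & v != 0.
  have : kermx X != 0.
    rewrite -mxrank_eq0 mxrank_ker subn_eq0 -ltnNge.
    exact: leq_ltn_trans (rank_leq_col X) ltUT.
  by case/rowV0Pn => v /sub_kermxP vX v0; exists v.
pose w (a : T) := v 0 (enum_rank a).
pose E := [set a | w a != 0].
pose g := \sum_(a in E) w a *: fe a.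
have gE : g = \sum_a w a *: fe a.
  rewrite [RHS](bigID (mem E)) /= [X in _ + X]big1 ?addr0 // => a.
  by rewrite inE negbK => /eqP ->; rewrite scale0r.
(* A monomial of [g] free of the variables in [A] would have degree at most [B], hence be some
   [mu b], whose coefficient is 0. *)
have g0 m : m \in msupp g -> exists2 i, i \in A & (0 < m i)%N.
  rewrite mcoeff_msupp => gm.
  have [/existsP [i /andP [iA hi]]|/existsPn h] := boolP [exists i in A, 0 < m
    i]%N.
    by exists i.
  case/eqP: gm.
  have [lem|ltm] := leqP (mdeg m) B; last first.
    rewrite gE raddf_sum big1 // => a _ /=; rewrite mcoeffZ.
    have /memN_msupp_eq0 -> : m \notin msupp (fe a).
      by apply/negP => /hfe; rewrite leqNgt ltm.
    by rewrite mulr0.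
  pose b : U := [ffun x => inord (m (val x))].
  have Em : m = mu b.
    apply/mnmP => i; rewrite mnmE; case: insubP => [x xA <-|].
      rewrite ffunE inordK // ltnS; apply: leq_trans lem.
      by rewrite mdegE (bigD1 (val x)) //= leq_addr.
    by rewrite negbK => iA; move: (h i); rewrite iA lt0n negbK => /eqP.
  move/rowP/(_ (enum_rank b)): vX; rewrite !mxE => <-.
  rewrite gE raddf_sum /= (reindex _ (onW_bij _ (@enum_val_bij T))) /=.
  by apply: eq_bigr => a _; rewrite mcoeffZ /w enum_valK mxE enum_rankK -Em.
have p0 := prime_p 0%N isT.
have pg : p 0%N g.
  rewrite [g]mpolyE big_seq; apply: prime_sum => // m /g0 [i iA mi].
  have le : (U_(i) <= m)%MM by rewrite lep1mP -lt0n.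
  rewrite -(submK le) mpolyXD scalerAl; case: (p0) => _ _ hM _ _.
  by apply: hM; apply: pA.
have [a0 wa0] : exists a, w a != 0.
  case/rV0Pn: v0 => a va; exists (enum_val a).
  by rewrite /w enum_valK.
pose f' i := f (inord i).
apply: (@chain_independent d.+1 D p f' _ _ _ _ w 0%N E).
- by move=> i h; apply: prime_p; apply: leq_trans lt.
- by move=> i h hi; apply: (chain i _).1; apply: leq_trans lt.
- by move=> i hi; have := (hf (inord i)).1; rewrite inordK.
- by move=> i hi; have := (hf (inord i)).2; rewrite inordK.
- by [].
- by apply/set0Pn; exists a0; rewrite inE.
- by move=> a; rewrite inE.
- by [].
suff <- : g = \sum_(a in E) w a *: (\prod_(i < d.+1 | (0 <= i)%N) f' i ^+ a i)
  by [].
apply: eq_bigr => a _; congr (_ *: _); apply: eq_bigr => i _.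
by rewrite /f' inord_val.
Qed.

End Krull.

(** * Annihilators of Ext *)

Section ExtAnnihilator.
Variables (k : fieldType) (n : nat).
Local Notation S := {mpoly k[n]}.

(* Multiplication by x on S/I factors through S/I'. *)
Section TwoQuotients.
Variables (I I' : S -> Prop) (x : S) (F H : gcomplex k n 1).
Hypotheses (sI : submod (@den _ _ (quoS I))) (sI' : submod (@den _ _ (quoS
  I'))).
Hypotheses (subI : forall f, I f -> I' f) (mulI : forall f, I' f -> I (x * f)).
Hypotheses (rF : resolves (quoS I) F) (rH : resolves (quoS I') H).

Lemma quotient_lifts :
  (exists alpha, lifts (quoS I') F H 1%:M alpha) /\
  (exists beta, lifts (quoS I) H F x%:M beta).
Proof.
split; [apply: (comparison (M' := quoS I')) | apply: (comparison (M' := quoS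
  I))] => //.
- exact: resolves_complex rF.
- by move=> w; rewrite mulmx1; apply: subI; apply: (resolves_den rF w).
- exact: resolves_complex rH.
- move=> w; rewrite mul_mx_scalar /= mxE; apply: mulI.
  exact: (resolves_den rH w).
Qed.

(** Multiplication by [x] on [F] is homotopic to a map through [H], which vanishes in degree [i.+1];
    transposing the homotopy writes [x *: v] as a coboundary. *)
Lemma Ext_killed i (v : 'rV_(crk F i.+1)) :
  crk H i.+1 = 0%N -> v *m (cd F i.+1)^T = 0 -> cobnd (x *: v).
Proof.
move=> H0 hv; have [[alpha [ca aa]] [beta [cb ab]]] := quotient_lifts.
have cF := resolves_complex rF.
pose phi j := alpha j *m beta j - x%:M.
have [|w|h [_ hS]] := @null_homotopic k n 1 (quoS I) F F phi cF rF.
- move=> j; rewrite /phi mulmxBl mulmxBr -mulmxA cb !mulmxA ca.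
  by rewrite scalar_mxC.
- have -> : w *m phi 0%N *m caug F =
      - (w *m alpha 0%N *m (caug H *m x%:M - beta 0%N *m caug F))
      - (w *m (caug F *m 1%:M - alpha 0%N *m caug H)) *m x%:M.
    rewrite /phi !mulmxBr !mulmxBl mulmx1 !mulmxA opprB opprB.
    by rewrite -[w *m x%:M *m _]mulmxA -scalar_mxC mulmxA [RHS]addrA subrK.
  apply: (submodB sI); first exact: (submodN sI).
  by rewrite mul_mx_scalar /= mxE; apply: mulI; apply: aa.
have E : phi i.+1 = - x%:M.
  rewrite /phi [_ *m _](_ : _ = 0) ?sub0r //.
  apply/matrixP => a b; rewrite !mxE big1 // => c.
  by case: (c) => c' hc; exfalso; move: hc; rewrite H0.
exists (- (v *m (h i)^T)).
rewrite mulNmx -mulmxA -trmx_mul.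
have -> : cd F i *m h i = - x%:M - h i.+1 *m cd F i.+1.
  by rewrite -E hS addrC addKr.
rewrite linearB linearN /= tr_scalar_mx mulmxBr mulmxN mul_mx_scalar.
by rewrite trmx_mul mulmxA hv mul0mx subr0 opprK.
Qed.

(** The composite in the other order is also homotopic to [x]. Basis vector [a] is a cocycle of [H];
    carried to [F], made a coboundary by [f] and carried back, it shows that [f * x] times it is a
    coboundary of [H], and coordinate [a] of any coboundary there lies in [P]. *)
Lemma Ext_support i (P : S -> Prop) (f : S) (a : 'I_(crk H i.+1)) :
  prime_ideal P -> (forall b, cd H i.+1 b a = 0) -> (forall b, P (cd H i a b))
    ->
  (forall v : 'rV_(crk F i.+1), v *m (cd F i.+1)^T = 0 -> cobnd (f *: v)) ->
  P (f * x).
Proof.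
move=> pP ha hP hf; have [[alpha [ca aa]] [beta [cb ab]]] := quotient_lifts.
have cH := resolves_complex rH.
pose phi j := beta j *m alpha j - x%:M.
have [|w|h [_ hS]] := @null_homotopic k n 1 (quoS I') H H phi cH rH.
- move=> j; rewrite /phi mulmxBl mulmxBr -mulmxA ca !mulmxA cb.
  by rewrite scalar_mxC.
- have -> : w *m phi 0%N *m caug H =
      - (w *m beta 0%N *m (caug F *m 1%:M - alpha 0%N *m caug H))
      - (w *m (caug H *m x%:M - beta 0%N *m caug F)).
    rewrite /phi !mulmxBr !mulmxBl mulmx1 !mulmxA opprB opprB.
    by rewrite -[w *m x%:M *m _]mulmxA -scalar_mxC mulmxA [RHS]addrA subrK.
  apply: (submodB sI'); first exact: (submodN sI').
  by apply: subI; apply: ab.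
pose e : 'rV[S]_(crk H i.+1) := delta_mx 0 a.
have eH : e *m (cd H i.+1)^T = 0.
  by rewrite -rowE; apply/rowP => b; rewrite !mxE.
have [|w /= hw] := hf (e *m (alpha i.+1)^T).
  by rewrite -mulmxA -trmx_mul -ca trmx_mul mulmxA eH mul0mx.
have E : (f * x) *: e = (w *m (beta i)^T - f *: (e *m (h i)^T)) *m (cd H i)^T.
  have Ex : e *m (alpha i.+1)^T *m (beta i.+1)^T =
       x *: e + e *m (h i)^T *m (cd H i)^T.
    rewrite -mulmxA -trmx_mul.
    have -> : beta i.+1 *m alpha i.+1 = x%:M + (h i.+1 *m cd H i.+1 + cd H i *m
      h i).
      by rewrite -hS /phi addrC subrK.
    rewrite !linearD /= tr_scalar_mx ?mulmxDr mul_mx_scalar !trmx_mul !mulmxA.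
    by rewrite eH mul0mx add0r.
  rewrite mulmxBl -scalemxAl -[w *m _ *m _]mulmxA -trmx_mul -cb trmx_mul mulmxA
    -hw.
  by rewrite -scalemxAl Ex scalerDr addrK scalerA.
have := congr1 (fun v : 'rV_(crk H i.+1) => v 0 a) E.
rewrite mxE [e _ _]mxE !eqxx mulr1 => ->; rewrite mxE.
by apply: prime_sum => // b _; rewrite [_^T _ _]mxE; case: (pP) => _ _ hM _ _;
  apply: hM.
Qed.
End TwoQuotients.

(** * Primes generated by variables *)

Definition varprime (A : {set 'I_n}) : S -> Prop :=
  monid (fun m => [exists i in A, m i != 0%N]).

Lemma varprime_upward (A : {set 'I_n}) :
  upward (fun m : 'X_{1..n} => [exists i in A, m i != 0%N]).
Proof.
move=> m m' /existsP [i /andP [iA mi]]; apply/existsP; exists i.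
by rewrite iA mnmDE addn_eq0 negb_and mi.
Qed.

Lemma varprimeX (A : {set 'I_n}) i : varprime A 'X_i <-> i \in A.
Proof.
rewrite /varprime monidX; split=> [/existsP [j]|iA].
  by rewrite mnm1E; have [->|_] := eqVneq i j; rewrite ?andbF // => /andP [].
by apply/existsP; exists i; rewrite iA mnm1E eqxx.
Qed.

(** Discard the terms involving [A]: if the remainders of [f] and [g] are nonzero, so is their
    product, and none of its terms involves [A]. *)
Lemma varprime_prime A : prime_ideal (varprime A).
Proof.
have up := @varprime_upward A.
split=> [|f g|f g||f g fg].
- exact: monid0.
- exact: monidD.
- exact: monidM.
- move=> /(_ 0%MM); rewrite mcoeff1 eqxx oner_eq0 => /(_ isT) /existsP [i].
  by rewrite mnm0E andbF.
have dec h : exists h1 h2, [/\ h = h1 + h2, varprime A h2 &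
    forall m, m \in msupp h1 -> forall i, i \in A -> m i = 0%N].
  have [m _|h2 [h1 [hh2 hh1 ->]]] := @monid_split k n
      (fun m => [exists i in A, m i != 0%N])
      (fun m => ~~ [exists i in A, m i != 0%N]) 0%MM 0%MM h.
    rewrite !subm0 (_ : (0 <= m)%MM = true) ?orbN //.
    by apply/mnm_lepP => i; rewrite mnm0E.
  exists h1, h2; rewrite mpolyX0 !mul1r addrC; split=> // m.
  rewrite mcoeff_msupp => /hh1 /existsPn hm i iA.
  by move: (hm i); rewrite iA negbK => /eqP.
have [f1 [f2 [Ef hf2 hf1]]] := dec f; have [g1 [g2 [Eg hg2 hg1]]] := dec g.
have [f10|f1n] := eqVneq f1 0; first by left; rewrite Ef f10 add0r.
have [g10|g1n] := eqVneq g1 0; first by right; rewrite Eg g10 add0r.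
have h : varprime A (f1 * g1).
  have -> : f1 * g1 = f * g + (- f1 * g2 + - g * f2).
    by rewrite Ef Eg; ring.
  by apply: monidD => //; apply: monidD; apply: monidM.
have /mlead_supp lm : f1 * g1 != 0 by rewrite mulf_neq0.
have /existsP [i /andP [iA]] : [exists i in A, mlead (f1 * g1) i != 0%N].
  by apply: h; rewrite -mcoeff_msupp.
have /allpairsP [[m1 m2] /= [h1 h2 ->]] := msuppM_le lm.
by rewrite mnmDE (hf1 _ h1 _ iA) (hg1 _ h2 _ iA).
Qed.

End ExtAnnihilator.

(** * Cover ideals *)

Section CoverIdeals.
Variables (k : fieldType) (n : nat) (e : rel 'I_n).
Hypothesis (e_sym : symmetric e).
Local Notation S := {mpoly k[n]}.
Implicit Types (V : {set 'I_n}) (v : 'I_n) (m : 'X_{1..n}).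

(** Stated for exponents, so that [monid (covers V)] is the cover ideal of the subgraph induced on
    [V], taken in the whole ring. *)
Definition covers V : pred 'X_{1..n} := fun m =>
  [forall i in V, forall j in V, e i j ==> (m i != 0%N) || (m j != 0%N)].

Lemma coversP V m :
  reflect (forall i j, i \in V -> j \in V -> e i j -> m i != 0%N \/ m j != 0%N)
          (covers V m).
Proof.
apply: (iffP forall_inP) => h i => [j iV jV eij|iV].
  by have /forall_inP /(_ j jV) /implyP /(_ eij) /orP := h i iV.
by apply/forall_inP => j jV; apply/implyP => eij; apply/orP; apply: h.
Qed.

Lemma covers_upward V : upward (covers V).
Proof.
move=> m m' /coversP h; apply/coversP => i j iV jV /(h _ _ iV jV).
by rewrite !mnmDE !addn_eq0 !negb_and => -[] ->; [left|right].
Qed.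

Lemma eq_covers V m m' : (forall i, i \in V -> m i = m' i) -> covers V m =
  covers V m'.
Proof.
move=> E; apply/coversP/coversP => h i j iV jV; have := h i j iV jV; by rewrite
  !E.
Qed.

Lemma coversS V V' m : V \subset V' -> covers V' m -> covers V m.
Proof.
move=> /subsetP sub /coversP h; apply/coversP => i j /sub iV /sub jV; exact: h.
Qed.

(** [mesym1 A] is the exponent of the product of the variables in [A]. *)
Local Notation supp := (@mesym1 n).

Lemma suppE (A : {set 'I_n}) i : supp A i = (i \in A).
Proof. by rewrite mnmE. Qed.

Lemma supp_le (A : {set 'I_n}) m : (supp A <= m)%MM = [forall i in A, m i !=
  0%N].
Proof.
apply/mnm_lepP/forall_inP => h i; last first.
  by rewrite suppE; case: (boolP (i \in A)) => // /h; rewrite lt0n.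
by move=> iA; have := h i; rewrite suppE iA lt0n.
Qed.

Local Notation J V := (subquo (@monid k n (covers V)) (fun f : S => f = 0)).

Lemma sub0 : submod (fun v : 'rV[S]_1 => v 0 0 = 0).
Proof.
split=> [|u v|c u]; rewrite !mxE; first by [].
  by move=> -> ->; rewrite addr0.
by move=> ->; rewrite mulr0.
Qed.

Lemma dsum_submod (N1 N2 : 'rV[S]_1 -> Prop) : submod N1 -> submod N2 ->
  submod (fun v : 'rV[S]_(1 + 1) => N1 (lsubmx v) /\ N2 (rsubmx v)).
Proof.
move=> [h01 hA1 hZ1] [h02 hA2 hZ2]; split=> [|u v [u1 u2] [v1 v2]|c u [u1 u2]].
- by rewrite !linear0.
- by rewrite !linearD /=; split; [apply: hA1 | apply: hA2].
- by rewrite !linearZ /=; split; [apply: hZ1 | apply: hZ2].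
Qed.

Lemma covers_nbr V v m : m v = 0%N -> v \in V -> covers V m ->
  (supp [set j in V | e v j] <= m)%MM.
Proof.
move=> mv vV /coversP h; rewrite supp_le; apply/forall_inP => j.
rewrite inE => /andP [jV ej]; case: (h v j vV jV ej) => //.
by rewrite mv.
Qed.

Lemma monid_eq0 (f : S) Q : f = 0 -> monid Q f.
Proof. by move=> ->; apply: monid0. Qed.

(* A cover of V contains v or its neighbours N, so J(V) is the sum of
   x_v J(V - v) and x_N J(V - v - N); the relations between the two summands
   form a copy of J(V - v - N). *)
Lemma cover_step V v (N := [set j in V | e v j])
    (R1 R2 : gcomplex k n 1) phi :
  v \in V -> ~~ e v v ->
  resolves (J (V :\ v)) R1 -> resolves (J (V :\ v :\: N)) R2 ->
  lifts (J (V :\ v)) R2 R1 ('X_[supp N])%:M phi ->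
  resolves (J V)
    (@cone k n 1 (1 + 1) 1 0 R2 (@dsum k n (J (V :\ v)) (J (V :\ v :\: N)) R1
      R2)
       (fun i => row_mx (phi i) (- 'X_v)%:M)
       (col_mx ('X_v)%:M ('X_[supp N])%:M)).
Proof.
move=> vV nvv; set V1 := V :\ v; set V2 := V1 :\: N => rR1 rR2 lphi.
have nvN : v \notin N by rewrite inE (negPf nvv) andbF.
have sV1 : V1 \subset V by apply: subsetDl.
have mulQ (w : 'rV[S]_(1 + 1)) :
    (w *m col_mx ('X_v)%:M ('X_[supp N])%:M) 0 0 =
    lsubmx w 0 0 * 'X_v + rsubmx w 0 0 * 'X_[supp N].
  rewrite -{1}[w]hsubmxK mul_row_col !mul_mx_scalar !mxE.
  by rewrite [X in X + _]mulrC [X in _ + X]mulrC.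
have sc c (u : 'rV[S]_1) : (c *: u) 0 0 = c * u 0 0 by rewrite mxE.
have cov2 m : covers V2 (supp N + m)%MM = covers V2 m.
  apply: eq_covers => i; rewrite mnmDE suppE inE.
  by case/andP => /negPf ->.
have cov2v m : covers V2 (U_(v) + m)%MM = covers V2 m.
  apply: eq_covers => i; rewrite mnmDE mnm1E !inE.
  by have [->|] := eqVneq v i; rewrite ?eqxx ?andbF.
(* The relation attached to h in J(V - v - N) is the pair (x_N h, - x_v h). *)
have lift2 : lifts (@dsum_mod k n (J V1) (J V2)) R2
      (@dsum k n (J V1) (J V2) R1 R2)
      (row_mx ('X_[supp N])%:M (- 'X_v)%:M)
      (fun i => row_mx (phi i) (- 'X_v)%:M).
  apply: (@dsum_lifts k n (J V1) (J V2) R1 R2 1 R2 _ _ phi (fun i => (-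
    'X_v)%:M)) => //.
  split=> [i|w]; first by rewrite scalar_mxC.
  by rewrite scalar_mxC subrr mulmx0 /= mxE.
refine (@cone_resolves k n (J V2) (@dsum_mod k n (J V1) (J V2)) (J V) 0 R2
   (@dsum k n (J V1) (J V2) R1 R2) _ _ _ _ _ _ _ rR2 _ lift2 _ _ _ _ _).
- by refine (@dsum_submod (fun w => monid (covers V1) (w 0 0))
     (fun w => monid (covers V2) (w 0 0)) _ _);
    apply: monid_submod; exact: covers_upward.
- refine (@dsum_submod (fun w => w 0 0 = 0) (fun w => w 0 0 = 0) _ _);
  exact: sub0.
- exact: sub0.
- by move=> w [/monid_eq0 h1 /monid_eq0 h2]; split; [apply: h1 | apply: h2].
- exact: dsum_resolves.
- move=> w [h1 h2] /=; rewrite mulQ; apply: monidD; rewrite mulrC;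
  apply/monidMX => m.
    move/h1 => /coversP c1; apply/coversP => i j iV jV eij; rewrite !mnmDE
      !mnm1E.
    have [_|ni] := eqVneq v i; first by left.
    have [_|nj] := eqVneq v j; first by right.
    by rewrite !add0n; apply: c1; rewrite // !inE eq_sym ?ni ?nj.
  move/h2 => /coversP c2; apply/coversP => i j iV jV eij; rewrite !mnmDE !suppE.
  have [iN|iN] := boolP (i \in N); first by left.
  have [jN|jN] := boolP (j \in N); first by right.
  rewrite !add0n; apply: c2 => //; rewrite !inE ?iV ?jV ?andbT /=.
    move: iN; rewrite inE iV /= => -> /=.
    by apply: contraNneq jN => iv; rewrite inE jV -iv.
  move: jN; rewrite inE jV /= => -> /=.
  by apply: contraNneq iN => jv; rewrite inE iV -jv e_sym.
(* A term of [u] not divisible by x_v is divisible by x_N, since its support covers the edges at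
   [v]. *)
- move=> u hu; have [m /hu hm|f1 [f2 [h1 h2 E]]] :=
      @monid_split k n (covers V1) (covers V2) U_(v)%MM (supp N) (u 0 0).
    have [mv|mv] := eqVneq (m v) 0%N.
      apply/orP; right; have le := covers_nbr mv vV hm.
      rewrite le /= -cov2 addmC submK //.
      by apply: coversS hm; apply: subset_trans sV1; apply: subsetDl.
    apply/orP; left; rewrite lep1mP mv /=.
    rewrite (@eq_covers _ _ m); first exact: coversS hm.
    by move=> i; rewrite !inE mnmBE mnm1E eq_sym; case: eqP; rewrite ?subn0.
  exists (row_mx f1%:M f2%:M).
    by split; rewrite /= ?row_mxKl ?row_mxKr mxE eqxx.
  rewrite /= mxE [X in _ + X]mxE mulQ row_mxKl row_mxKr E.
  by rewrite !mxE eqxx !mulr1n mulrC [f2 * _]mulrC subrr.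
- move=> w [h1 h2] /=; rewrite mulQ.
  have den2 (u : 'rV[S]_1) :
      @den _ _ (@dsum_mod k n (J V1) (J V2))
        (w - u *m row_mx ('X_[supp N])%:M (- 'X_v)%:M) <->
      lsubmx w 0 0 = 'X_[supp N] * u 0 0 /\ rsubmx w 0 0 = - 'X_v * u 0 0.
    rewrite /= mul_mx_row !linearB /= row_mxKl row_mxKr !mul_mx_scalar.
    have aux (a b : 'rV[S]_1) : (a - b) 0 0 = 0 <-> a 0 0 = b 0 0.
      by rewrite mxE [(- b) 0 0]mxE; split=> /eqP; [rewrite subr_eq0|rewrite
        -subr_eq0] => /eqP.
    split=> -[E1 E2]; split.
    - by move/aux: E1 => ->; apply: sc.
    - by move/aux: E2 => ->; apply: sc.
    - by apply/aux; rewrite E1 sc.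
    - by apply/aux; rewrite E2 sc.
  split=> [E|[u _ /den2 [-> ->]]]; last by ring.
  (* Writing l and r for the two components, x_v l = - x_N r; as [v] is not in [N], every term of l
     is divisible by x_N. *)
  have [g Eg] : exists g, lsubmx w 0 0 = 'X_[supp N] * g.
    apply: mpolyX_dvd => m hm.
    have : ('X_v * lsubmx w 0 0)@_(U_(v) + m) != 0.
      by rewrite mcoeffXM lem_addr addmC addmK.
    have -> : 'X_v * lsubmx w 0 0 = 'X_[supp N] * - rsubmx w 0 0.
      by move/eqP: E; rewrite addr_eq0 mulrC => /eqP ->; rewrite mulrN mulrC.
    rewrite mcoeffXM; case: ifP => [le _|]; last by rewrite eqxx.
    apply/mnm_lepP => i; move/mnm_lepP/(_ i): le; rewrite mnmDE mnm1E suppE.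
    by have [<-|] := eqVneq v i; rewrite ?(negPf nvN).
  have Eg2 : rsubmx w 0 0 = - 'X_v * g.
    apply: (mulfI (mpolyX_neq0 k (supp N))).
    apply/eqP; rewrite -subr_eq0 -[X in _ == X]E Eg; apply/eqP; ring.
  (* [g] lies in J(V - v - N), because x_v g = - r does and [v] is not a vertex there. *)
  exists (const_mx g); last by apply/den2; rewrite [const_mx g _ _]mxE.
  rewrite /= mxE => m hm; rewrite -cov2v; apply: h2.
  by rewrite Eg2 mulNr mcoeffN oppr_eq0 mcoeffXM lem_addr addmC addmK.
- move=> u /= Eu; rewrite mul_mx_row row_mxKl row_mxKr !mul_mx_scalar.
  by rewrite !sc Eu !mulr0.
- move=> u _ [/= E _]; apply/eqP; move/eqP: E.
  rewrite mul_mx_row row_mxKl mul_mx_scalar mxE mulf_eq0.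
  by rewrite (negPf (mpolyX_neq0 k _)).
Qed.
End CoverIdeals.

Arguments covers {n} e V.

(** * Lengths of resolutions of cover ideals *)

Section CoverResolutions.
Variables (k : fieldType) (n : nat) (e : rel 'I_n).
Hypotheses (e_sym : symmetric e) (e_irr : irreflexive e).
Local Notation S := {mpoly k[n]}.
Local Notation supp := (@mesym1 n).
Local Notation J V := (subquo (@monid k n (covers e V)) (fun f : S => f = 0)).
Implicit Types (V W : {set 'I_n}) (m : 'X_{1..n}).

(** Cone over the inclusion of J(V) into S. *)
Lemma cover_quotient V R : resolves (J V) R ->
  exists phi, resolves (quoS (monid (covers e V)))
    (@cone k n 1 1 1 0 R (unit_cpx k n) phi 1%:M).
Proof.
move=> rR; have rU := unit_cpx_resolves k n.
have [//|w|phi lphi] := comparison (M' := quoS (fun f : S => f = 0)) (P := 1%:M)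
    (@sub0 k n) (resolves_complex rR) _ _ rU.
  by rewrite mulmx1; apply: (resolves_den rR w).
exists phi.
refine (@cone_resolves k n (J V) (quoS (fun f : S => f = 0))
  (quoS (monid (covers e V))) 0 R (unit_cpx k n) phi 1%:M 1%:M
  _ _ _ _ rR rU lphi _ _ _ _ _) => //=.
- exact: sub0.
- apply: monid_submod; exact: covers_upward.
- by move=> u _; exists u => //; rewrite mulmx1 subrr mxE; apply: monid0.
- move=> w _; rewrite mulmx1; split=> [h|[u hu]].
    by exists w => //; rewrite mulmx1 subrr mxE.
  by rewrite mulmx1 mxE [(- u) 0 0]mxE => /eqP; rewrite subr_eq0 => /eqP ->.
- by move=> u; rewrite mulmx1.
- by move=> u _; rewrite mulmx1.
Qed.

Lemma cover_no_edge V m :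
  (forall i j, i \in V -> j \in V -> ~~ e i j) -> covers e V m.
Proof.
by move=> h; apply/coversP => i j iV jV; rewrite (negPf (h i j iV jV)).
Qed.

Lemma unit_resolves_cover V :
  (forall i j, i \in V -> j \in V -> ~~ e i j) -> resolves (J V) (unit_cpx k n).
Proof.
move=> h.
apply: (@resolves_ext k n (fun _ => True) _ (fun f => f = 0)) => // [f|].
  by split=> // _ m _; apply: cover_no_edge.
exact: unit_cpx_resolves.
Qed.

(** Pick a vertex [v] with a neighbour. [V - v] has one vertex less, and J(V - v - N), which also
    enters one homological degree higher, has lost at least two. *)
Lemma cover_resolution V :
  exists2 R, resolves (J V) R & forall i, (#|V| < i.*2)%N -> crk R i = 0%N.
Proof.
have [N] := ubnP #|V|; elim: N V => // N IH V; rewrite ltnS => leN.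
have [/exists_inP [v vV /exists_inP [w wV evw]]|h] :=
    boolP [exists v in V, exists w in V, e v w]; last first.
  exists (unit_cpx k n) => [|[|i]] //.
  apply: unit_resolves_cover => i j iV jV; apply: contra h => eij.
  by apply/exists_inP; exists i => //; apply/exists_inP; exists j.
pose Nv := [set j in V | e v j].
have cV1 : #|V :\ v|.+1 = #|V| by rewrite (cardsD1 v V) vV.
have cV2 : (#|V :\ v :\: Nv| < #|V :\ v|)%N.
  have wv : w != v by apply: contraTneq evw => ->; rewrite e_irr.
  rewrite -(cardsID Nv (V :\ v)) -[X in (X < _)%N]add0n ltn_add2r.
  by apply/card_gt0P; exists w; rewrite !inE wv wV evw.
have [|R1 rR1 d1] := IH (V :\ v); first by lia.
have [|R2 rR2 d2] := IH (V :\ v :\: Nv); first by lia.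
have [u|u|phi lphi] := comparison (M' := J (V :\ v)) (P := ('X_[supp Nv])%:M)
    (@sub0 k n) (resolves_complex rR2) _ _ rR1.
- rewrite mul_mx_scalar /= mxE; apply/monidMX => m hm.
  have /coversP c2 : covers e (V :\ v :\: Nv) m by case: rR2 => -[/(_ u) /(_ m
    hm)].
  apply/coversP => i j iV jV eij; rewrite !mnmDE !suppE.
  have [iN|iN] := boolP (i \in Nv); first by left.
  have [jN|jN] := boolP (j \in Nv); first by right.
  by rewrite !add0n; apply: c2 => //; rewrite in_setD ?iN ?jN.
- rewrite mul_mx_scalar /= mxE; have /= -> := resolves_den rR2 u.
  by rewrite mulr0.
have rC := cover_step e_sym vV (negbT (e_irr v)) rR1 rR2 lphi.
exists (@cone k n 1 (1 + 1) 1 0 R2 (@dsum k n (J (V :\ v)) (J (V :\ v :\: Nv))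
  R1 R2)
       (fun i => row_mx (phi i) (- 'X_v)%:M)
       (col_mx ('X_v)%:M ('X_[supp Nv])%:M)) => //.
case=> [|i] lt //=; rewrite d1 ?d2 //; lia.
Qed.

Lemma cover_quotient_resolution V i : (#|V| + 2 < i.*2)%N ->
  exists2 H, resolves (quoS (@monid k n (covers e V))) H & crk H i = 0%N.
Proof.
case: i => // i lt; have [R rR dR] := cover_resolution V.
have [phi rC] := cover_quotient rR.
exists (@cone k n 1 1 1 0 R (unit_cpx k n) phi 1%:M) => //.
by rewrite /= dR //; lia.
Qed.

(** * Resolutions along an induced matching *)

Definition verts (l : seq ('I_n * 'I_n)) : {set 'I_n} :=
  [set i | has (fun ab => (i == ab.1) || (i == ab.2)) l].

(** An induced matching as a list of oriented edges, in a form suited to removing one edge at a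
    time. *)
Fixpoint disjoint_edges (l : seq ('I_n * 'I_n)) : bool :=
  if l is (a, b) :: l' then
    [&& e a b, a \notin verts l', b \notin verts l',
        [forall c in verts l', ~~ e a c && ~~ e b c] & disjoint_edges l']
  else true.

(** No differential leaves degree 0, so the condition is empty there; this starts the induction in
    [matching_resolution]. *)
Definition toprow (P : S -> Prop) (R : gcomplex k n 1) i : 'I_(crk R i) -> Prop
  :=
  match i return 'I_(crk R i) -> Prop with
  | 0 => fun _ => True
  | j.+1 => fun a => forall b, P (cd R j a b)
  end.

Lemma verts_cons a b l : verts ((a, b) :: l) = a |: (b |: verts l).
Proof. by apply/setP => i; rewrite !inE /= orbA. Qed.

(** Apply [cover_step] at [a], whose only neighbour is [b]. Both smaller cover ideals equal that of
    [verts l], as [b] is isolated once [a] is gone; so the cone joins two copies of [R] to a shifted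
    one by x_b and - x_a. [W] stays fixed in the induction. *)
Lemma matching_resolution l W : disjoint_edges l -> verts l \subset W ->
  exists R, [/\ resolves (J (verts l)) R,
    forall i, (size l < i)%N -> crk R i = 0%N &
    exists a, @toprow (varprime W) R (size l) a].
Proof.
elim: l => [_ _|[a b] l IH].
  exists (unit_cpx k n); split=> [|[|i]|] //; last by exists 0.
  by apply: unit_resolves_cover => i; rewrite inE.
move=> /= /and5P [eab al bl /forall_inP noe dl].
rewrite verts_cons; have [Vl EV] : {Vl | Vl = verts l} by exists (verts l).
rewrite -EV in al bl noe IH * => sub.
have [aW bW lW] : [/\ a \in W, b \in W & Vl \subset W].
  split; first by apply: (subsetP sub); rewrite !inE eqxx.
    by apply: (subsetP sub); rewrite !inE eqxx orbT.
  by apply: subset_trans sub; rewrite setUA subsetUr.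
have [R [rR dR [t ht]]] := IH dl lW.
set V := a |: (b |: Vl).
have ab : a != b by apply: contraTneq eab => ->; rewrite e_irr.
have EN : [set j in V | e a j] = [set b].
  apply/setP => j; rewrite !inE.
  apply/andP/eqP => [[/or3P [/eqP -> | /eqP -> | jl] eaj]|->]; last 1 first.
  - by rewrite eqxx orbT.
  - by rewrite e_irr in eaj.
  - by [].
  - by have := noe j jl; rewrite eaj.
have E1 : V :\ a = b |: Vl.
  by rewrite /V setU1K // !inE negb_or ab al.
have E2 : V :\ a :\: [set j in V | e a j] = Vl.
  by rewrite E1 EN setU1K.
have rR2 : resolves (J (V :\ a :\: [set j in V | e a j])) R by rewrite E2.
have rR1 : resolves (J (V :\ a)) R.
  apply: (@resolves_ext k n _ _ _ _ R _ _ rR) => // f; apply: eq_monid => m.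
  rewrite E1; apply/coversP/coversP => h i j; last first.
    by move=> il jl; apply: h; rewrite !inE ?il ?jl orbT.
  rewrite !inE => /orP [/eqP ->|il] /orP [/eqP ->|jl]; last exact: h.
  - by rewrite e_irr.
  - by have /andP [_ /negPf ->] := noe j jl.
  - by rewrite e_sym; have /andP [_ /negPf ->] := noe i il.
pose phi i : 'M[S]_(crk R i) := ('X_[supp [set j in V | e a j]])%:M.
have lphi : lifts (J (V :\ a)) R R ('X_[supp [set j in V | e a j]])%:M phi.
  split=> [i|w]; first by rewrite /phi scalar_mxC.
  by rewrite /phi scalar_mxC subrr mulmx0 /= mxE.
have aV : a \in V by rewrite !inE eqxx.
have rC := cover_step e_sym aV (negbT (e_irr a)) rR1 rR2 lphi.
eexists; split; first exact: rC.
  by case=> [|i] lt //=; rewrite !dR // ltnW.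
(* The basis element [t] of the shifted copy: its row has entries x_b, - x_a, 0 and minus those of
   the old row. *)
exists (rshift _ t) => c /=.
have up := @varprime_upward n W.
have hphi i (j : 'I_(crk R i)) (j' : 'I_(crk R i + crk R i)) :
    varprime W (row_mx (phi i) (- 'X_a)%:M j j').
  rewrite mxE; case: (split j') => j''; rewrite mxE; case: eqP => _;
    rewrite ?mulr1n ?mulr0n; try exact: monid0.
    rewrite EN mesym1_set1; apply/varprimeX; exact: bW.
  rewrite -mulN1r; apply: monidM => //; exact/varprimeX.
case: (size l) t ht c => [|r] t ht c /=.
  by rewrite col_mxEd; apply: hphi.
rewrite mxE (unsplitK (inr t)) mxE; case: (split c) => d; first exact: hphi.
by rewrite mxE -mulN1r; apply: monidM => //; apply: ht.
Qed.

Lemma matching_quotient_resolution l W : disjoint_edges l -> verts l \subset W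
  ->
  (0 < size l)%N ->
  exists2 H, resolves (quoS (@monid k n (covers e (verts l)))) H &
    exists a : 'I_(crk H (size l).+1),
      (forall b, cd H (size l).+1 b a = 0) /\
      (forall b, varprime W (cd H (size l) a b)).
Proof.
move=> dl lW; have [R [rR dR [t]]] := matching_resolution dl lW.
have [phi rC] := cover_quotient rR.
case: (size l) dR t => // r dR t ht _.
exists (@cone k n 1 1 1 0 R (unit_cpx k n) phi 1%:M) => //.
exists (rshift _ t); split=> [b|b].
  (* Nothing lies above the last degree, so this column has no entries. *)
  by exfalso; case: b => b /=; rewrite dR.
(* Above degree 0 [unit_cpx] is zero, so only minus the row of [t] in [R] remains. *)
rewrite /= mxE (unsplitK (inr t)) mxE; case: (split b) => [[]//|d].
rewrite mxE -mulN1r; apply: monidM; first exact: varprime_upward.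
exact: ht.
Qed.

(** An edge not inside [V] has an end outside it, whose variable divides the multiplier. *)
Lemma covers_mul_supp V m : covers e V m -> covers e setT (supp (~: V) + m)%MM.
Proof.
move=> /coversP h; apply/coversP => i j _ _ eij; rewrite !mnmDE !suppE !inE.
have [iV|iV] := boolP (i \in V); last by left.
have [jV|jV] := boolP (j \in V); last by right.
by rewrite !add0n; apply: h.
Qed.

End CoverResolutions.

(** * Induced matchings *)

Section Matchings.
Variables (n : nat) (e : rel 'I_n).
Hypotheses (e_sym : symmetric e) (e_irr : irreflexive e).

Lemma edgesP (A : {set 'I_n}) :
  reflect (exists a b, e a b /\ A = [set a; b]) (A \in edges e).
Proof.
apply: (iffP imsetP) => [[[a b]]|[a [b [eab ->]]]].
  by rewrite inE /= => eab ->; exists a, b.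
by exists (a, b); rewrite ?inE.
Qed.

(** Formulated for a sublist [L], so that the induction keeps [M] fixed and any number of its edges
    can be taken. *)
Lemma matching_verts (M : {set {set 'I_n}}) (L : seq {set 'I_n}) :
  induced_matching e M -> uniq L -> {subset L <= M} ->
  exists l, [/\ size l = size L, disjoint_edges e l &
    forall i, i \in verts l <-> exists2 A, A \in L & i \in A].
Proof.
case/andP => /andP [/subsetP sM /trivIsetP tM] /forall_inP indM.
elim: L => [_ _|A L IH /= /andP [AL uL] sL].
  exists [::]; split=> // i; rewrite inE; split=> // -[A]; by rewrite in_nil.
have [|l [sl dl vl]] := IH uL; first by move=> B BL; apply: sL; rewrite in_cons
  BL orbT.
have AM : A \in M by apply: sL; rewrite mem_head.
have LM B : B \in L -> B \in M by move=> BL; apply: sL; rewrite in_cons BL orbT.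
have /edgesP [a [b [eab EA]]] := sM A AM.
have share B C c : B \in M -> C \in M -> c \in B -> c \in C -> B = C.
  move=> BM CM cB cC; apply/eqP; apply: contraTT cC => ne.
  by rewrite (disjointFr (tM B C BM CM ne) cB).
have notin c : c \in A -> c \notin verts l.
  move=> cA; apply/negP => /vl [B BL cB]; move: AL.
  by rewrite (share A B c AM (LM B BL) cA cB) BL.
have noe c d : c \in A -> d \in verts l -> ~~ e c d.
  move=> cA /vl [B BL dB]; apply/negP => ecd.
  have CE : [set c; d] \in edges e by apply/edgesP; exists c, d.
  (* This edge lies in the union of [M], so inducedness puts it into [M]; meeting both [A] and [B],
     it then equals both. *)
  have CM : [set c; d] \in M.
    apply: contraT => nCM; have := indM [set c; d]; rewrite inE nCM CE => /(_
      isT).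
    rewrite subUset !sub1set => /nandP [] /bigcupP []; first by exists A.
    by exists B => //; apply: LM.
  have ccd : c \in [set c; d] by rewrite !inE eqxx.
  have dcd : d \in [set c; d] by rewrite !inE eqxx orbT.
  move: AL; rewrite (share A _ c AM CM cA ccd).
  by rewrite (share _ B d CM (LM B BL) dcd dB) BL.
have aA : a \in A by rewrite EA !inE eqxx.
have bA : b \in A by rewrite EA !inE eqxx orbT.
exists ((a, b) :: l); split=> /=.
- by rewrite sl.
- rewrite eab !notin // dl andbT /=; apply/forall_inP => c cl.
  by rewrite !noe.
- move=> i; rewrite verts_cons setUA -EA in_setU.
  split=> [/orP [iA|/vl [B BL iB]]|[B]].
  + by exists A; rewrite ?mem_head.
  + by exists B; rewrite // in_cons BL orbT.
  + by rewrite in_cons => /orP [/eqP -> ->//|BL iB]; apply/orP; right;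
    apply/vl; exists B.
Qed.

Lemma im_disjoint_edges r : (r <= im e)%N -> exists2 l, disjoint_edges e l &
  size l = r.
Proof.
(* The empty set is an induced matching, so the maximum defining [im] is attained. *)
have P0 : (0 < #|[pred M | induced_matching e M]|)%N.
  apply/card_gt0P; exists set0; rewrite inE /induced_matching /matching sub0set
    /=.
  apply/andP; split; first by apply/trivIsetP => A B; rewrite inE.
  apply/forall_inP => A; rewrite inE => /andP [_ /edgesP [a [b [_ ->]]]].
  by rewrite /cover big_set0 subset0; apply/set0Pn; exists a; rewrite !inE eqxx.
rewrite /im; have [M iM ->] := eq_bigmax_cond (fun M : {set {set 'I_n}} =>
  #|M|) P0.
move=> rM; have [||l [sl dl _]] := @matching_verts M (take r (enum M)) iM.
- by rewrite take_uniq ?enum_uniq.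
- by move=> A /mem_take; rewrite mem_enum.
by exists l => //; rewrite sl size_takel // -cardE.
Qed.

Lemma card_verts l : disjoint_edges e l -> #|verts l| = (size l).*2.
Proof.
elim: l => [_|[a b] l IH /and5P [eab al bl _ dl]].
  by apply: eq_card0 => i; rewrite inE.
have ab : a != b by apply: contraTneq eab => ->; rewrite e_irr.
by rewrite verts_cons !cardsU1 in_setU1 (negPf ab) (negPf al) bl IH.
Qed.

Lemma edge_in_matching l i j : disjoint_edges e l ->
  i \in verts l -> j \in verts l -> e i j -> ((i, j) \in l) || ((j, i) \in l).
Proof.
elim: l => [_|[a b] l IH /and5P [eab al bl /forall_inP noe dl]].
  by rewrite inE.
rewrite verts_cons !in_setU1 !in_cons !xpair_eqE => /or3P hi /or3P hj eij.
case: hi hj => [/eqP Ei|/eqP Ei|il] [/eqP Ej|/eqP Ej|jl]; subst; rewrite ?eqxx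
  ?orbT //.
- by rewrite e_irr in eij.
- by move: (noe _ jl); rewrite eij.
- by rewrite e_irr in eij.
- by move: (noe _ jl); rewrite eij andbF.
- by move: (noe _ il); rewrite e_sym eij.
- by move: (noe _ il); rewrite [e b _]e_sym eij andbF.
- by case/orP: (IH dl il jl eij) => ->; rewrite !orbT.
Qed.

Lemma disjoint_edges_mem l a b : disjoint_edges e l -> (a, b) \in l ->
  [/\ e a b, a \in verts l & b \in verts l].
Proof.
elim: l => // -[c d] l IH /and5P [ecd _ _ _ dl].
rewrite in_cons verts_cons !in_setU1 => /orP [/eqP [-> ->]|/(IH dl) [-> -> ->]].
  by rewrite !eqxx orbT.
by rewrite !orbT.
Qed.

End Matchings.

(** * The edge ideal and the cover ideal of the graph *)

Section Main.
Variables (k : fieldType) (n : nat) (e : rel 'I_n).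
Hypotheses (e_sym : symmetric e) (e_irr : irreflexive e).
Local Notation S := {mpoly k[n]}.
Implicit Types (m : 'X_{1..n}).

(** An equality of predicates, not an equivalence: [resolution] is a choice depending on the module,
    so the ideal has to be rewritten inside it. *)
Lemma genideal_dvd_some (T : finType) (P : pred T) (g : T -> S)
    (w : T -> 'X_{1..n}) : (forall t, g t = 'X_[w t]) ->
  genideal P g = monid (dvd_some [seq w t | t <- enum P]).
Proof.
move=> hg; have -> : g = fun t => 'X_[w t] by apply: functional_extensionality.
apply: functional_extensionality => f; apply: propositional_extensionality.
rewrite genideal_monid; apply: eq_monid => m.
apply/existsP/hasP => [[t /andP [Pt le]]|[u /mapP [t Pt ->] le]].
  by exists (w t) => //; apply: map_f; rewrite mem_enum.
by exists t; rewrite mem_enum in Pt; apply/andP.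
Qed.

Definition edge_monomials : seq 'X_{1..n} :=
  [seq (U_(ij.1) + U_(ij.2))%MM | ij <- enum (fun ij : 'I_n * 'I_n => e ij.1
    ij.2)].

Lemma edge_idealE : edge_ideal e k = monid (dvd_some edge_monomials).
Proof. by apply: genideal_dvd_some => ij; rewrite mpolyXD. Qed.

Lemma mpolyX_supp (A : {set 'I_n}) :
  \prod_(i in A) 'X_i = 'X_[mesym1 A] :> S.
Proof.
rewrite mprodXE; congr 'X_[_]; apply/mnmP => i; rewrite mnm_sumE suppE.
have [iA|iA] := boolP (i \in A).
  rewrite (bigD1 i) //= mnm1E eqxx big1 // => j /andP [_ /negPf ji].
  by rewrite mnm1E ji.
rewrite big1 // => j jA; rewrite mnm1E; case: eqP => // E.
by rewrite E (negPf iA) in jA.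
Qed.

Definition cover_monomials : seq 'X_{1..n} :=
  [seq mesym1 C | C <- enum (vertex_cover e)].

Lemma covers_dvd_some : dvd_some cover_monomials = covers e setT.
Proof.
apply: functional_extensionality => m.
apply/hasP/coversP => [[_ /mapP [C + ->]]|h].
  rewrite mem_enum => /forall_inP cC; rewrite supp_le => /forall_inP le i j _ _
    eij.
  have /set0Pn [c] : [set i; j] :&: C != set0.
    by apply: cC; apply/edgesP; exists i, j.
  by rewrite !inE => /andP [/orP [] /eqP -> /le]; [left | right].
(* The support of [m] is a vertex cover whose monomial divides x^m. *)
exists (mesym1 [set i | m i != 0%N]); last first.
  by rewrite supp_le; apply/forall_inP => i; rewrite inE.
apply: map_f; rewrite mem_enum; apply/forall_inP => A /edgesP [a [b [eab ->]]].
apply/set0Pn; case: (h a b) => // ha; [exists a | exists b];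
  by rewrite !inE ha eqxx ?orbT.
Qed.

Lemma cover_idealE : cover_ideal e k = monid (covers e setT).
Proof.
rewrite -covers_dvd_some; apply: genideal_dvd_some => C; exact: mpolyX_supp.
Qed.

Lemma betti_edge_le i j :
  betti (quoS (edge_ideal e k)) i j <> 0%N -> j <= (2 * i)%N%:Z.
Proof.
rewrite edge_idealE; apply: betti_le; apply/allP => _ /mapP [[a b] _ ->].
by rewrite mdegD !mdeg1.
Qed.

(** [betti_koszul] with the matching edges as [u] and the variables off the matching as [t]. *)
Lemma betti_edge_neq0 l : disjoint_edges e l ->
  betti (quoS (edge_ideal e k)) (size l) (size l).*2%:Z <> 0%N.
Proof.
move=> dl; rewrite edge_idealE.
pose u : seq 'X_{1..n} := [seq (U_(ab.1) + U_(ab.2))%MM | ab <- l].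
pose t : seq 'X_{1..n} := [seq U_(i)%MM | i <- enum (~: verts l)].
have U1 (a i : 'I_n) : (U_(a)%MM i == 0%N) = (a != i).
  by rewrite mnm1E; case: (a == i).
have cop2 (a b c : 'I_n) : a != c -> b != c -> coprimem U_(c) (U_(a) + U_(b)).
  move=> ac bc; apply/forallP => i; rewrite mnmDE addn_eq0 !U1.
  by have [<-|//] := eqVneq c i; rewrite ac bc.
have cop : pairwise coprimem (t ++ u).
  rewrite pairwise_cat; apply/and3P; split.
  - apply/allrelP => _ _ /mapP [c hc ->] /mapP [[a b] hab ->].
    move: hc; rewrite mem_enum inE => cl.
    have [_ al bl] := disjoint_edges_mem dl hab.
    by apply: cop2 => /=; [apply: contraTneq al | apply: contraTneq bl] => ->.
  - rewrite pairwise_map; apply: (@sub_pairwise _ (fun i j => i != j)).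
      move=> i j ij; apply/forallP => c; rewrite !U1.
      by have [<-|//] := eqVneq i c; rewrite eq_sym.
    by rewrite -uniq_pairwise enum_uniq.
  - rewrite pairwise_map; elim: (l) dl => //= -[a b] l' IH /and5P [eab al bl _
    dl'].
    rewrite IH // andbT; apply/allP => -[c d] /(disjoint_edges_mem dl') [_ cl
      dl''].
    have [nca nda] : c != a /\ d != a by split; apply: contraNneq al => <-.
    have [ncb ndb] : c != b /\ d != b by split; apply: contraNneq bl => <-.
    apply/forallP => i; rewrite /= !mnmDE !addn_eq0 !U1.
    have [<-|_] := eqVneq a i; first by rewrite nca nda orbT.
    by have [<-|//] := eqVneq b i; rewrite ncb ndb orbT.
have nu : all (fun g => g != 0%MM) (t ++ u).
  rewrite all_cat !all_map; apply/andP; split; apply/allP => x _ /=.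
    by rewrite -mdeg_eq0 mdeg1.
  by rewrite -mdeg_eq0 mdegD !mdeg1.
have := @betti_koszul k n edge_monomials t u cop nu.
have -> : size u = size l by rewrite size_map.
have -> : (\sum_(g <- u) mdeg g)%N = (size l).*2.
  rewrite big_map (eq_bigr (fun _ => 2%N)) ?big_const_seq.
    by rewrite count_predT iter_addn_0 mul2n.
  by move=> ab _; rewrite mdegD !mdeg1.
apply=> m /hasP [_ /mapP [[a b] ab ->] le].
  apply/hasP; exists (U_(a) + U_(b))%MM => //.
  apply: (map_f (fun ij : 'I_n * 'I_n => (U_(ij.1) + U_(ij.2))%MM) (x := (a,
    b))).
  by rewrite mem_enum; have [] := disjoint_edges_mem dl ab.
(* An edge with an end off the matching is a multiple of a variable in [t]; any other edge belongs
   to the matching. *)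
have hU i : i \in verts l \/ (m i != 0%N -> dvd_some (t ++ u) m).
  have [il|il] := boolP (i \in verts l); [by left | right=> mi].
  apply/hasP; exists U_(i)%MM; last by rewrite lep1mP.
  by rewrite mem_cat map_f // mem_enum inE.
have la := mnm_lepP le a; have lb := mnm_lepP le b.
rewrite /= !mnmDE !mnm1E !eqxx in la lb.
have [al|] := hU a; last by apply; lia.
have [bl|] := hU b; last by apply; lia.
rewrite mem_enum in ab.
apply/hasP; exists (U_(a) + U_(b))%MM => //; rewrite mem_cat; apply/orP; right.
case/orP: (edge_in_matching e_sym e_irr dl al bl ab) => h.
  exact: (map_f (fun ij : 'I_n * 'I_n => (U_(ij.1) + U_(ij.2))%MM) h).
rewrite addmC; exact: (map_f (fun ij : 'I_n * 'I_n => (U_(ij.1) + U_(ij.2))%MM)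
  h).
Qed.

(** * Dimension of the Ext modules of S/J(G) *)

Local Notation M := (quoS (@monid k n (covers e setT))).
Local Notation supp := (@mesym1 n).

Lemma resolution_cover : resolves M (resolution M).
Proof.
have [] := resolution_monid k cover_monomials.
by rewrite covers_dvd_some.
Qed.

Lemma covers_den (V : {set 'I_n}) :
  submod (@den _ _ (quoS (@monid k n (covers e V)))).
Proof. apply: monid_submod; exact: covers_upward. Qed.

Lemma monid_coversS (V : {set 'I_n}) (f : S) :
  monid (covers e setT) f -> monid (covers e V) f.
Proof. by move=> h m /h; apply: coversS; apply: subsetT. Qed.

Lemma monid_covers_supp (V : {set 'I_n}) (f : S) :
  monid (covers e V) f -> monid (covers e setT) ('X_[supp (~: V)] * f).
Proof. by move=> h; apply/monidMX => m /h; apply: covers_mul_supp. Qed.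

(** By the length bound S/J(V) has a resolution that is zero in degree [i.+1], so [Ext_killed]
    applies. *)
Lemma ann_Ext_cover (V : {set 'I_n}) i :
  (#|V| + 2 < i.+1.*2)%N -> ann (Ext M i.+1) 'X_[supp (~: V)].
Proof.
move=> lt; have [H rH dH] := cover_quotient_resolution k e_sym e_irr lt.
move=> v /= hv.
exact: (Ext_killed (covers_den setT) (covers_den V) (@monid_coversS V)
  (@monid_covers_supp V)
          resolution_cover rH dH hv).
Qed.

Lemma supp_notin_varprime (A : {set 'I_n}) : ~ @varprime k n A 'X_[supp (~: A)].
Proof.
move/monidX/existsP => [i /andP [iA]].
by rewrite suppE inE iA.
Qed.

(** The product of [f] with all variables off the matching lies in the prime, and none of these
    variables does. *)
Lemma Ext_cover_support l (f : S) : disjoint_edges e l -> (0 < size l)%N ->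
  ann (Ext M (size l).+1) f -> varprime (verts l) f.
Proof.
move=> dl l0 hf.
have [H rH [a [a0 ha]]] :=
  matching_quotient_resolution k e_sym e_irr dl (subxx _) l0.
have pW := varprime_prime k (verts l).
have := Ext_support (covers_den setT) (covers_den (verts l))
  (@monid_coversS (verts l)) (@monid_covers_supp (verts l)) resolution_cover rH
  pW a0 ha hf.
by case: pW => _ _ _ _ h /h [//|] /supp_notin_varprime.
Qed.

(** The chain starts at the prime of the matching variables and adds the other variables one at a
    time. *)
Lemma kdim_ge_Ext_cover l : disjoint_edges e l -> (0 < size l)%N ->
  kdim_ge (Ext M (size l).+1) (n - (size l).*2)%N%:Z.
Proof.
move=> dl l0; have [W EW] : {W | W = verts l} by exists (verts l).
pose c := enum (~: W); pose A i := W :|: [set x in take i c].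
have sc : size c = (n - (size l).*2)%N.
  by rewrite -cardE cardsCs setCK card_ord EW (card_verts e_irr dl).
exists (n - (size l).*2)%N, (fun i => varprime (A i)); split=> //.
- by move=> i _; apply: varprime_prime.
- move=> f /(Ext_cover_support dl l0); rewrite -EW => h m /h /existsP [i /andP
  [iW mi]].
  by apply/existsP; exists i; rewrite inE iW.
move=> i lt; have lt' : (i < size c)%N by rewrite sc.
have [x0 _] : exists x0 : 'I_n, true.
  by case: (c) lt' => // x c' _; exists x.
have Ec : take i.+1 c = rcons (take i c) (nth x0 c i) by rewrite -take_nth.
split=> [f h m /h /existsP [j /andP [jA mj]]|].
  apply/existsP; exists j; rewrite mj andbT; move: jA.
  by rewrite !inE Ec mem_rcons in_cons => /orP [->|->]; rewrite ?orbT.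
exists 'X_(nth x0 c i); rewrite !varprimeX !inE Ec mem_rcons mem_head orbT;
  split=> //.
have : nth x0 c i \in c by apply: mem_nth.
rewrite mem_enum inE => /negPf -> /=.
have : uniq (take i.+1 c) by rewrite take_uniq ?enum_uniq.
by rewrite Ec rcons_uniq => /andP [/negP].
Qed.

(** Let [U] be the set of variables outside [p 0]. [krull_bound] gives a - r + 1 <= |U|, so at most
    i + r variables lie in [p 0]. If r < i, this is below 2i, and [ann_Ext_cover] puts the product
    over [U] into the prime [p 0], a contradiction. *)
Lemma kdim_ge_Ext_cover_le i r a : (a + i.+1 = n)%N ->
  kdim_ge (Ext M i.+1) (a%:Z - r%:Z + 1) -> (n <= a + r + 1)%N.
Proof.
move=> ain [t [p [tge prime_p annp chain]]]; rewrite leqNgt; apply/negP => lt.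
pose U : {set 'I_n} := [set j | ~~ excluded_middle_informative (p 0%N 'X_j)].
have pU j : (j \in U) -> ~ p 0%N 'X_j.
  by rewrite inE; case: excluded_middle_informative.
have nU j : j \in ~: U -> p 0%N 'X_j.
  by rewrite !inE negbK; case: excluded_middle_informative.
have p0 := prime_p 0%N isT.
have tU := krull_bound prime_p nU chain.
rewrite setCK in tU.
have cU : (#|~: U| + #|U| = n)%N by rewrite addnC cardsC card_ord.
have := @ann_Ext_cover (~: U) i; rewrite setCK => /(_ _)/annp => h.
have {h} : p 0%N 'X_[supp U] by apply: h; lia.
rewrite -mpolyX_supp -big_enum => /(prime_prod p0) [j].
by rewrite mem_enum => /pU.
Qed.

End Main.

Theorem proposition5p2 (k : fieldType) (n : nat) (e : rel 'I_n)
    (e_sym : symmetric e) (e_irr : irreflexive e)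
    (reg_im : is_reg (quoS (edge_ideal e k)) (im e)%:Z) :
  (forall i : nat, (i <= im e)%N ->
     ismax (fun j : int => betti (quoS (edge_ideal e k)) i (i%:Z + j) <> 0%N)
       i%:Z)
  /\
  (forall r : nat, (2 <= r)%N -> (r <= im e)%N ->
     is_Sr_depth r (quoS (cover_ideal e k)) (n - r - 1)%N).
Proof.
split=> [i /(im_disjoint_edges) [l dl <-]|r r2 /(im_disjoint_edges) [l dl sl]].
  split=> [|j /betti_edge_le]; last by rewrite mul2n -addnn PoszD lerD2l.
  by rewrite -PoszD addnn; apply: betti_edge_neq0.
(* This keeps the truncated subtractions from [n] exact. *)
have ln : ((size l).*2 <= n)%N.
  by rewrite -(card_verts e_irr dl) -[n in (_ <= n)%N]card_ord max_card.
rewrite cover_idealE; split=> [|a].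
  rewrite /Kmod; have -> : (n - r - 1 <= n)%N by lia.
  have -> : (n - (n - r - 1) = (size l).+1)%N by lia.
  (* For j = n - r - 1 the required dimension j - r + 1 is n - 2r. *)
  have -> : (n - r - 1)%N%:Z - r%:Z + 1 = (n - (size l).*2)%N%:Z by lia.
  by apply: kdim_ge_Ext_cover => //; lia.
rewrite /Kmod; case: leqP => [le|lt _]; last by lia.
(* For [a = n] the Ext module has index 0, outside the range of the bound, and the inequality is
   immediate. *)
have [an|ne] := eqVneq a n; first by move=> _; lia.
have -> : (n - a = (n - a).-1.+1)%N by lia.
by move/(kdim_ge_Ext_cover_le e_sym e_irr); lia.
Qed.
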